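(* Let $\mathbf{\Phi^+}=\mathbf{\Phi^+}(C_0^+(X))$, and consider the map $\Pi:\mathbf{DTM}(X)\to\mathbf{\Phi^+}$, $\Pi(\mu)=\mathcal{R}_\mu$. Then: (I) $\Pi$ is conic-linear, i.e. $\Pi(c\mu+d\nu)=c\,\Pi(\mu)+d\,\Pi(\nu)$ for all $c,d\ge0$ and $\mu,\nu\in\mathbf{DTM}(X)$. (II) $\mu\le\nu$ if and only if $\Pi(\mu)\le\Pi(\nu)$ (i.e. $\mathcal{R}_\mu(f)\le\mathcal{R}_\nu(f)$ for all $f\in C_0^+(X)$). (III) For $\mu\in\mathbf{DTM}(X)$ put $\rho(f)=\Pi(\mu)(f^+)-\Pi(\mu)(f^-)$ for $f\in C_0(X)$. Then $\mu\in\mathbf{TM}(X)$ if and only if $\rho$ is a quasi-linear functional on $C_0(X)$, and $\mu\in\mathbf{M}(X)$ if and only if $\rho$ is a linear functional on $C_0(X)$. (IV) $\|\mathcal{R}_\mu\|=\mu(X)$. (V) The map $\Pi:\mathbf{DTM}(X)\to\mathbf{\Phi^+}$ is a conic-linear order-preserving bijection such that $\|\mathcal{R}_\mu\|=\mu(X)$.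
   Context: $X$ is a locally compact Hausdorff connected space; $\mathscr{O}(X),\mathscr{C}(X),\mathscr{K}(X)$ are the families of open, closed, compact subsets. $C_b(X)$, $C_0(X)$: real continuous functions that are bounded, respectively vanish at infinity (sup norm); $C_0(X)=C(X)$ if $X$ is compact. $C_0^+(X)=\{f\in C_0(X): f\ge0\}$; $f^+=\max(f,0)$, $f^-=\max(-f,0)$. A deficient topological measure on $X$ is $\nu:\mathscr{C}(X)\cup\mathscr{O}(X)\to[0,\infty]$ such that: (1) $\nu(C\sqcup K)=\nu(C)+\nu(K)$ for disjoint $C,K\in\mathscr{K}(X)$; (2) $\nu(U)=\sup\{\nu(C): C\subseteq U, C\in\mathscr{K}(X)\}$ for open $U$; (3) $\nu(F)=\inf\{\nu(U): F\subseteq U\in\mathscr{O}(X)\}$ for closed $F$. A topological measure satisfies (2), (3) and, instead of (1): if $A,B,A\sqcup B\in\mathscr{K}(X)\cup\mathscr{O}(X)$ then $\mu(A\sqcup B)=\mu(A)+\mu(B)$. $\mathbf{DTM}(X)$, $\mathbf{TM}(X)$ are the sets of finite ($\mu(X)<\infty$) deficient topological measures and topological measures; $\mathbf{M}(X)$ is the set of restrictions to $\mathscr{O}(X)\cup\mathscr{C}(X)$ of finite Borel measures that are inner regular with respect to compact sets on open sets and outer regular. Order and conic combinations of set functions are pointwise on sets. For $f\in C_0(X)$ let $A^+(f)$ be the set of functions $\phi\circ f$ with $\phi:\overline{f(X)}\to\mathbb{R}$ continuous non-decreasing, where additionally $\phi(0)=0$ is required if $X$ is not compact. Functionals take values in $[-\infty,\infty]$,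 attain at most one of $\pm\infty$, are not identically $\infty$ or $-\infty$. A functional $\rho$ on $C_0^+(X)$ with $|\rho(0)|<\infty$ is p-conic quasi-linear if on $C_0^+(X)$: (p1) $fg=0$ implies $\rho(f+g)=\rho(f)+\rho(g)$; (p2) $g\le f$ implies $\rho(g)\le\rho(f)$; (p3) for each $f\in C_0(X)$, if $g,h\in A^+(f)\cap C_0^+(X)$ and $a,b\ge0$, then $\rho(ag+bh)=a\rho(g)+b\rho(h)$. $\|\rho\|=\sup\{|\rho(f)|: f \text{ in the domain},\ \|f\|\le1\}$; $\mathbf{\Phi^+}(C_0^+(X))$ is the set of those with $\|\rho\|<\infty$. A quasi-linear functional on $C_0(X)$ is a real-valued map $\rho$ with: $\rho(af)=a\rho(f)$ for $a\in\mathbb{R}$; for each $h\in C_0(X)$, $\rho(f+g)=\rho(f)+\rho(g)$ for $f,g\in B(h)$, where $B(h)$ is the smallest uniformly closed subalgebra of $C_0(X)$ containing $h$ (and also the constant $1$ if $X$ is compact); and $f\ge0$ implies $\rho(f)\ge0$. For $\mu\in\mathbf{DTM}(X)$ and $f\in C_b(X)$, let $R_1(t)=\mu(f^{-1}((t,\infty)))$ and let $r$ be the Lebesgue–Stieltjes measure on $\mathbb{R}$ associated with the non-decreasing function $-R_1$. Then $\mathcal{R}_\mu(f)=\int_{\mathbb{R}}t\,dr(t)$; here it is restricted to $C_0^+(X)$. *)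

(* Defs.v *)
From HB Require Import structures.
From mathcomp Require Import all_boot all_order all_algebra.
From mathcomp Require Import all_classical all_reals all_analysis.

Set Implicit Arguments.
Unset Strict Implicit.
Unset Printing Implicit Defensive.

Import Order.TTheory GRing.Theory Num.Theory.
Import numFieldNormedType.Exports.

Local Open Scope classical_set_scope.
Local Open Scope ring_scope.

(* Encoding of domains.  Set functions on O(X) u C(X) are represented by total
   functions [set X -> \bar R] that vanish outside O(X) u C(X), and functionals
   on C_0^+(X) by total functions [(X -> R) -> \bar R] that vanish outside
   C_0^+(X).  Leibniz equality of representatives is thus equality of the
   represented maps, and pointwise operations are unaffected. *)

Definition zero_outside (T : Type) (R : realType) (D : set T)
  (F : T -> \bar R) : Prop := forall x, ~ D x -> F x = 0%E.

Section SetFunctions.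
Context {R : realType} {X : ptopologicalType}.
Implicit Types (nu mu : set X -> \bar R) (A B C K F U : set X).

Definition open_or_closed : set (set X) := [set A | open A \/ closed A].
Definition compact_or_open : set (set X) := [set A | compact A \/ open A].

Definition nonneg_set_function nu : Prop :=
  forall A, open_or_closed A -> (0 <= nu A)%E.

Definition inner_regular_on_open nu : Prop :=
  forall U, open U -> nu U = ereal_sup [set nu C | C in
    [set C | compact C /\ C `<=` U]].

Definition outer_regular_on_closed nu : Prop :=
  forall F, closed F -> nu F = ereal_inf [set nu U | U in
    [set U | open U /\ F `<=` U]].

Definition deficient_topological_measure nu : Prop :=
  [/\ nonneg_set_function nu,
      forall C K, compact C -> compact K -> C `&` K = set0 ->
        nu (C `|` K) = (nu C + nu K)%E,
      inner_regular_on_open nu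
    & outer_regular_on_closed nu].

Definition topological_measure mu : Prop :=
  [/\ nonneg_set_function mu,
      forall A B, compact_or_open A -> compact_or_open B ->
        compact_or_open (A `|` B) -> A `&` B = set0 ->
        mu (A `|` B) = (mu A + mu B)%E,
      inner_regular_on_open mu
    & outer_regular_on_closed mu].

Definition DTM : set (set X -> \bar R) :=
  [set nu | [/\ deficient_topological_measure nu, (nu setT < +oo)%E
              & zero_outside open_or_closed nu]].

Definition TM : set (set X -> \bar R) :=
  [set mu | [/\ topological_measure mu, (mu setT < +oo)%E
              & zero_outside open_or_closed mu]].

Definition Mreg : set (set X -> \bar R) :=
  [set mu | zero_outside open_or_closed mu /\
    exists m : {measure set (g_sigma_algebraType (@open X)) -> \bar R},
    [/\ (m setT < +oo)%E,
        forall U, open U -> m U = ereal_sup [set m C | C in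
          [set C | compact C /\ C `<=` U]],
        forall A, (@open X).-sigma.-measurable A ->
          m A = ereal_inf [set m U | U in [set U | open U /\ A `<=` U]]
      & forall A, open_or_closed A -> mu A = m A]].

End SetFunctions.
Arguments DTM : clear implicits.
Arguments TM : clear implicits.
Arguments Mreg : clear implicits.

Section FunctionSpaces.
Context {R : realType} {X : ptopologicalType}.
Implicit Types (f g h : X -> R).

Definition vanishes_at_infinity f : Prop :=
  forall e : R, 0 < e -> compact [set x | e <= `|f x|].

Definition C0 : set (X -> R) :=
  [set f | continuous f /\ vanishes_at_infinity f].

Definition C0plus : set (X -> R) :=
  [set f | C0 f /\ forall x, 0 <= f x].

Definition supnorm f : \bar R := ereal_sup (range (fun x => `|f x|%:E)).

Definition Aplus f : set (X -> R) :=
  [set g | exists phi : R -> R,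
    [/\ {within closure (range f), continuous phi},
        {in closure (range f) &, {homo phi : s t / s <= t}},
        ~ compact [set: X] -> phi 0 = 0
      & g = phi \o f]].

(* [A] is closed in the topology of uniform convergence on all functions; as
   [C0] is closed there too, this is closedness in [C0]. *)
Definition closed_subalgebra (A : set (X -> R)) : Prop :=
  [/\ A `<=` C0, A (cst 0),
      forall (a b : R) f g, A f -> A g -> A (fun x => a * f x + b * g x),
      forall f g, A f -> A g -> A (f \* g)
    & closed (A : set {uniform X -> R})].

Definition Balg h : set (X -> R) :=
  smallest closed_subalgebra
    [set f | f = h \/ (compact [set: X] /\ f = cst 1)].

End FunctionSpaces.
Arguments C0 : clear implicits.
Arguments C0plus : clear implicits.

Section Functionals.
Context {R : realType} {X : ptopologicalType}.
Implicit Types (rho : (X -> R) -> \bar R) (D : set (X -> R)).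
Local Open Scope ereal_scope.

Definition functional_on D rho : Prop :=
  [/\ ~ ((exists2 f, D f & rho f = +oo) /\ (exists2 f, D f & rho f = -oo)),
      exists2 f, D f & rho f != +oo
    & exists2 f, D f & rho f != -oo].

Definition functional_norm D rho : \bar R :=
  ereal_sup [set `|rho f| | f in [set f | D f /\ supnorm f <= 1]].

Definition p_conic_quasi_linear rho : Prop :=
  [/\ functional_on (C0plus R X) rho /\ `|rho (cst 0%R)| < +oo,
      forall f g, C0plus R X f -> C0plus R X g ->
        (forall x, f x * g x = 0)%R ->
        rho (fun x => f x + g x)%R = rho f + rho g,
      forall f g, C0plus R X f -> C0plus R X g ->
        (forall x, g x <= f x)%R -> rho g <= rho f
    & forall f, C0 R X f -> forall g h,
        (Aplus f `&` C0plus R X) g -> (Aplus f `&` C0plus R X) h ->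
        forall a b : R, (0 <= a)%R -> (0 <= b)%R ->
        rho (fun x => a * g x + b * h x)%R = a%:E * rho g + b%:E * rho h].

Definition Phiplus : set ((X -> R) -> \bar R) :=
  [set rho | [/\ p_conic_quasi_linear rho,
                 functional_norm (C0plus R X) rho < +oo
               & zero_outside (C0plus R X) rho]].

Definition quasi_linear_functional rho : Prop :=
  [/\ forall f, C0 R X f -> rho f \is a fin_num,
      forall (a : R) f, C0 R X f -> rho (fun x => a * f x)%R = a%:E * rho f,
      forall h, C0 R X h -> forall f g, Balg h f -> Balg h g ->
        rho (fun x => f x + g x)%R = rho f + rho g
    & forall f, C0 R X f -> (forall x, 0 <= f x)%R -> 0 <= rho f].

Definition linear_functional rho : Prop :=
  [/\ forall f, C0 R X f -> rho f \is a fin_num,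
      forall (a : R) f, C0 R X f -> rho (fun x => a * f x)%R = a%:E * rho f
    & forall f g, C0 R X f -> C0 R X g ->
        rho (fun x => f x + g x)%R = rho f + rho g].

End Functionals.
Arguments Phiplus : clear implicits.

Section LebesgueStieltjes.
Context {R : realType}.

Definition is_cumulative (F : R -> R) : Prop :=
  {homo F : x y / x <= y} /\ right_continuous F.

(* Total version of [lebesgue_stieltjes_measure].  The default value [mzero] is
   never used below: see [is_cumulative_opp_R1]. *)
Definition ls_measure (F : R -> R) : {measure set (measurableTypeR R) -> \bar R} :=
  match pselect (is_cumulative F) with
  | left h => lebesgue_stieltjes_measure
      (HB.pack_for (cumulative R R) F (isCumulative.Build R _ R F h.1 h.2))
  | right _ => mzero
  end.

Lemma ls_measureE (F : cumulative R R) :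
  ls_measure F = lebesgue_stieltjes_measure F :> (set _ -> _).
Proof.
rewrite /ls_measure; case: pselect => [[h1 h2]|]; last first.
  by case; split; [exact: cumulative_is_nondecreasing |
    exact: cumulative_is_right_continuous].
case: F h1 h2 => F [[k1 k2]] h1 h2.
by rewrite (Prop_irrelevance h1 k1) (Prop_irrelevance h2 k2).
Qed.

End LebesgueStieltjes.

Section Representation.
Context {R : realType} {X : ptopologicalType}.
Implicit Types (mu nu : set X -> \bar R) (f : X -> R).

Definition R1 mu f (t : R) : R := fine (mu (f @^-1` `]t, +oo[)).

Lemma le_open mu U V : inner_regular_on_open mu -> open U -> open V ->
  U `<=` V -> (mu U <= mu V)%E.
Proof.
move=> irmu oU oV UV; rewrite (irmu _ oU) (irmu _ oV).
apply: ereal_sup_le => _ [C [cC CU] <-]; exists C => //; split => //.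
exact: subset_trans CU UV.
Qed.

Lemma is_cumulative_opp_R1 mu f : DTM R X mu -> continuous f ->
  is_cumulative (fun t => - R1 mu f t).
Proof.
move=> [[mu0 _ irmu _] muT _] cf.
have oU t : open (f @^-1` `]t, +oo[).
  by move/continuousP : cf; apply; exact: interval_open.
have fU t : mu (f @^-1` `]t, +oo[) \is a fin_num.
  rewrite ge0_fin_numE; last by apply: mu0; left.
  by apply: le_lt_trans muT; apply: le_open => //; exact: openT.
have ndR : {homo (fun t => - R1 mu f t) : x y / x <= y}.
  move=> s t st; rewrite lerN2 fine_le//; apply: le_open => // x /=.
  by rewrite !in_itv/= !andbT; exact: le_lt_trans.
split => // t; apply/cvgrPdist_le => e e0.
have := fU t; rewrite {1}(irmu _ (oU t)) => fsup.
have [_ [C [cC CU] <-]] := ub_ereal_sup_adherent e0 fsup.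
rewrite -(irmu _ (oU t)) => muC.
have [m tm Cm] : exists2 m, t < m & forall x, C x -> m <= f x.
  have [->|/set0P Cn0] := eqVneq C set0; first by exists (t + 1); rewrite ?ltrDl.
  have cfC : {within C, continuous f} by exact: continuous_subspaceT.
  have [c /set_mem Cc cmin] := compact_EVT_min Cn0 cC cfC.
  exists (f c); last by move=> x /mem_set; exact: cmin.
  by have := CU _ Cc; rewrite /= in_itv/= andbT.
near=> s.
have ts : t < s by near: s; exact: nbhs_right_gt.
have sm : s < m by near: s; exact: nbhs_right_lt.
have := ndR _ _ (ltW ts) => Rts.
rewrite distrC ger0_norm ?subr_ge0// opprK addrC lerBlDl.
rewrite -lee_fin EFinD !fineK// -leeBlDr//.
apply: le_trans (ltW muC) _.
rewrite (irmu _ (oU s)); apply: ereal_sup_ubound; exists C => //; split => //.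
by move=> x Cx /=; rewrite in_itv/= andbT (lt_le_trans sm)// Cm.
Unshelve. all: end_near. Qed.

Definition Rfun mu f : \bar R :=
  (\int[ls_measure (fun t => - R1 mu f t)%R]_t t%:E)%E.

Definition Pi mu : (X -> R) -> \bar R := Rfun mu \_ (C0plus R X).

End Representation.

Section ConeMaps.
Local Open Scope ereal_scope.

Definition conic_comb (T : Type) (R : realType) (c d : R) (F G : T -> \bar R) :
  T -> \bar R := fun x => c%:E * F x + d%:E * G x.

Definition le_on (T : Type) (R : realType) (D : set T) (F G : T -> \bar R) :
  Prop := forall x, D x -> F x <= G x.

Context {R : realType} {X : ptopologicalType}.
Variable P : (set X -> \bar R) -> ((X -> R) -> \bar R).

Definition conic_linear_on_DTM : Prop :=
  forall (c d : R) (mu nu : set X -> \bar R),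
    (0 <= c)%R -> (0 <= d)%R -> DTM R X mu -> DTM R X nu ->
    DTM R X (conic_comb c d mu nu) /\
    P (conic_comb c d mu nu) = conic_comb c d (P mu) (P nu).

Definition order_preserving_on_DTM : Prop :=
  forall mu nu : set X -> \bar R, DTM R X mu -> DTM R X nu ->
    (le_on open_or_closed mu nu <-> le_on (C0plus R X) (P mu) (P nu)).

Definition norm_total_mass_on_DTM : Prop :=
  forall mu : set X -> \bar R, DTM R X mu ->
    functional_norm (C0plus R X) (P mu) = mu [set: X].

End ConeMaps.

(* Main.v *)
Require Import Defs.
From HB Require Import structures.
From mathcomp Require Import finmap.
From mathcomp Require Import all_boot all_order all_algebra.
From mathcomp Require Import all_classical all_reals all_analysis.
From mathcomp Require Import measurable_realfun ring lra.

(** The proof rests on one formula.  For a finite deficient topological measure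
    [mu] and [f >= 0] vanishing at infinity, the Stieltjes measure of [- R1 mu f]
    gives mass [mu (f > t)] to the ray above [t] and no mass to the negative
    half-line, so the layer cake formula turns [Pi mu f] into the integral over
    [t >= 0] of the tail [mu (f > t)] ([Pi_tail]).  Conic linearity in [mu],
    monotonicity in [f] and in [mu], additivity on functions with product zero, and
    the bounds [mu K <= Pi mu f <= mu U] for an Urysohn function [f] of a compact
    [K] inside an open [U] can then be read off the tails.  The bounds recover [mu]
    from [Pi mu], hence the order equivalence, the injectivity and the norm formula.

    The same formula holds on any finite measure space: if [psi] on such a space
    has the same tails as [g], then [Pi mu g] is the integral of [psi]
    ([Pi_layer]).  All the additivity statements come from this principle, by
    transporting several functions to one measure space where integration is linear.
    - For [g] and [h] nondecreasing functions of the same [f], the space is the real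
      line with the Stieltjes measure of [f].  A superlevel set of [g] is then either
      a superlevel set of [f], or a set [f >= c] which is open and closed; by
      connectedness the latter is the whole space ([ls_monotone_lift]).  This is
      what makes [Pi mu] a p-conic quasi-linear functional.
    - For a topological measure, the space is again the real line, but now all functions of
      one [h >= 0] that vanish with [h] are allowed, because the Stieltjes measure of
      [h] gives a compact set of positive reals the mass of its preimage
      ([compact_level]): the preimages of a compact set and of its complement in a ray
      have at least the Stieltjes mass of these sets, and the two sums coincide.
    - For a regular Borel measure, the space is [X] itself.

    Surjectivity: a functional [rho] induces the set function whose value on an open
    [U] is the supremum of [rho g] over the [g <= 1] vanishing off [U].  It is a
    deficient topological measure, and [rho f] is recovered by cutting [f] into
    horizontal slices of height [e]: each slice is squeezed between [e] times the mass
    of two consecutive superlevel sets, and the two bounds telescope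
    ([conic_squeeze]).

    Conversely, quasi-linearity forces [mu U <= mu K + mu (U minus K)].  With [s]
    equal to 1 on [K], at least 1/2 on a large compact part of [U], and at most 1/2
    off a small neighbourhood of [K], one applies quasi-linearity to [s ^ n] and
    [1 - (1 - s) ^ n - s ^ n], which are polynomials in [s] without constant term
    ([quasi_linear_bump]).  Linearity forces countable subadditivity on open sets, and
    the outer measure generated by [mu] is then a regular Borel measure by
    Caratheodory's criterion ([linear_Mreg]). *)

Set Implicit Arguments.
Unset Strict Implicit.
Unset Printing Implicit Defensive.

Import Order.TTheory GRing.Theory Num.Theory.
Import numFieldNormedType.Exports.

Local Open Scope classical_set_scope.
Local Open Scope ring_scope.

(** * Continuous functions vanishing at infinity *)

Section C0_theory.
Context {R : realType} {X : ptopologicalType}.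
Implicit Types (f g h : X -> R).

Lemma closed_superlevel f (e : R) : continuous f -> closed [set x | e <= f x].
Proof.
move=> cf; have -> : [set x | e <= f x] = f @^-1` `[e, +oo[.
  by apply/seteqP; split => x /=; rewrite in_itv/= andbT.
apply: closed_comp; [by move=> x _; exact: cf|exact: interval_closed].
Qed.

Lemma open_superlevel f (e : R) : continuous f -> open [set x | e < f x].
Proof.
move=> cf; have -> : [set x | e < f x] = f @^-1` `]e, +oo[.
  by apply/seteqP; split => x /=; rewrite in_itv/= andbT.
by move/continuousP : cf; apply; exact: interval_open.
Qed.

Lemma open_sublevel f (e : R) : continuous f -> open [set x | f x < e].
Proof.
move=> cf; have -> : [set x | f x < e] = f @^-1` `]-oo, e[.
  by apply/seteqP; split => x /=; rewrite in_itv/=.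
by move/continuousP : cf; apply; exact: interval_open.
Qed.

Lemma continuous_normf f : continuous f -> continuous (fun x => `|f x|).
Proof. by move=> cf x; apply: cvg_norm; exact: cf. Qed.

(** The workhorse for membership in [C0]: a superlevel set of [g] is a closed
    subset of the union of two compact superlevel sets. *)
Lemma C0_dom f1 f2 g (c : R) : C0 R X f1 -> C0 R X f2 -> continuous g ->
  (forall x, `|g x| <= c * (`|f1 x| + `|f2 x|)) -> C0 R X g.
Proof.
move=> [cf1 vf1] [cf2 vf2] cg gle; split => // e e0.
have [c' c'0 gle'] : exists2 c' : R, 0 < c' &
    forall x, `|g x| <= c' * (`|f1 x| + `|f2 x|).
  exists (`|c| + 1); first by rewrite ltr_wpDl.
  move=> x; apply: le_trans (gle x) _; apply: ler_wpM2r.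
    exact: addr_ge0.
  by rewrite (le_trans (ler_norm _))// lerDl.
pose d := e / (2 * c').
have d0 : 0 < d by rewrite divr_gt0// mulr_gt0.
apply: subclosed_compact (compactU (vf1 _ d0) (vf2 _ d0)) _.
  by apply: closed_superlevel; exact: continuous_normf.
move=> x /= eg; have [|f1d] := leP d `|f1 x|; first by left.
have [|f2d] := leP d `|f2 x|; first by right.
have := le_trans eg (gle' x); rewrite leNgt => /negP; case.
have -> : e = c' * (d + d).
  by rewrite /d; field; rewrite gt_eqF.
by rewrite ltr_pM2l// ltrD.
Qed.

Lemma C0_cst0 : C0 R X (cst 0).
Proof.
split; first exact: cst_continuous.
move=> e e0; rewrite (_ : [set _ | _] = set0); first exact: compact0.
by rewrite -subset0 => x /=; rewrite normr0 leNgt e0.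
Qed.

Lemma C0_dom1 f g (c : R) : C0 R X f -> continuous g ->
  (forall x, `|g x| <= c * `|f x|) -> C0 R X g.
Proof.
move=> f0 cg gle; apply: (C0_dom f0 C0_cst0 cg) => x.
by rewrite normr0 addr0; exact: gle.
Qed.

Lemma C0_lin f g (a b : R) : C0 R X f -> C0 R X g ->
  C0 R X (fun x => a * f x + b * g x).
Proof.
move=> f0 g0; apply: (@C0_dom _ _ _ (`|a| + `|b|) f0 g0).
  move=> x; apply: cvgD; apply: cvgM; try exact: cvg_cst; [exact: f0.1|exact: g0.1].
move=> x; rewrite (le_trans (ler_normD _ _))// !normrM mulrDr lerD//.
  by rewrite ler_wpM2r// lerDl.
by rewrite ler_wpM2r// lerDr.
Qed.

Lemma C0_add f g : C0 R X f -> C0 R X g -> C0 R X (fun x => f x + g x).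
Proof.
move=> f0 g0; have := C0_lin 1 1 f0 g0.
by under eq_fun do rewrite !mul1r.
Qed.

Lemma C0_scale f (a : R) : C0 R X f -> C0 R X (fun x => a * f x).
Proof.
move=> f0; have := C0_lin a 0 f0 f0.
by under eq_fun do rewrite mul0r addr0.
Qed.

Lemma continuous_funrpos f : continuous f -> continuous (f^\+)%R.
Proof.
move=> cf x; apply: (@continuous_max R X f (cst 0) x); first exact: cf.
exact: cst_continuous.
Qed.

Lemma continuous_funrneg f : continuous f -> continuous (f^\-)%R.
Proof.
move=> cf x; apply: (@continuous_max R X (\- f) (cst 0) x); last exact: cst_continuous.
by apply: continuousN; exact: cf.
Qed.

Lemma C0_bounded f : C0 R X f -> exists2 M : R, 0 < M & forall x, `|f x| <= M.
Proof.
move=> [cf vf].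
have [S0|/set0P Sn0] := eqVneq [set x | 1 <= `|f x|] set0.
  exists 1 => // x; rewrite leNgt; apply/negP => /ltW fx.
  by have : set0 x by rewrite -S0.
have cS : {within [set x | 1 <= `|f x|], continuous (fun x => `|f x|)}.
  by apply: continuous_subspaceT; exact: continuous_normf.
have [c _ cM] := compact_EVT_max Sn0 (vf _ ltr01) cS.
exists (`|f c| + 1); first by rewrite ltr_wpDl.
move=> x; have [fx|/ltW fx] := leP 1 `|f x|.
  by rewrite (le_trans (cM x _)) ?inE// lerDl.
by rewrite (le_trans fx)// lerDr.
Qed.

Lemma C0_mul f g : C0 R X f -> C0 R X g -> C0 R X (fun x => f x * g x).
Proof.
move=> f0 g0; have [M M0 fM] := C0_bounded f0.
apply: (@C0_dom1 g _ M g0) => [x|x].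
  by apply: cvgM; [exact: f0.1|exact: g0.1].
by rewrite normrM ler_wpM2r.
Qed.

Lemma C0_pos f : C0 R X f -> C0plus R X (f^\+)%R.
Proof.
move=> f0; split; last by move=> x; exact: funrpos_ge0.
apply: (@C0_dom1 f _ 1 f0); first exact: continuous_funrpos f0.1.
move=> x; rewrite mul1r ger0_norm ?funrpos_ge0// /funrpos.
by rewrite ge_max normr_ge0 ler_norm.
Qed.

Lemma C0_neg f : C0 R X f -> C0plus R X (f^\-)%R.
Proof.
move=> f0; split; last by move=> x; exact: funrneg_ge0.
apply: (@C0_dom1 f _ 1 f0); first exact: continuous_funrneg f0.1.
move=> x; rewrite mul1r ger0_norm ?funrneg_ge0// /funrneg.
by rewrite ge_max normr_ge0 -normrN ler_norm.
Qed.

Lemma C0plus_lin f g (a b : R) : C0plus R X f -> C0plus R X g ->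
  0 <= a -> 0 <= b -> C0plus R X (fun x => a * f x + b * g x).
Proof.
move=> [f0 fp] [g0 gp] a0 b0; split; first exact: C0_lin.
by move=> x; rewrite addr_ge0// mulr_ge0.
Qed.

Lemma C0plus_dom f g (c : R) : C0plus R X f -> continuous g ->
  (forall x, 0 <= g x <= c * f x) -> C0plus R X g.
Proof.
move=> [f0 fp] cg gf; split; last by move=> x; case/andP: (gf x).
apply: (C0_dom1 (c := c) f0 cg) => x; case/andP: (gf x) => g0 gle.
by rewrite !ger0_norm.
Qed.

Lemma C0_cst (a : R) : compact [set: X] -> C0 R X (cst a).
Proof.
move=> cX; split; first exact: cst_continuous.
move=> e e0; apply: (subclosed_compact _ cX) => //.
by apply: closed_superlevel; apply: continuous_normf; exact: cst_continuous.
Qed.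

Lemma compact_superlevel g (t : R) : C0plus R X g -> 0 < t ->
  compact [set x | t <= g x].
Proof.
move=> g0 t0; rewrite (_ : [set x | _] = [set x | t <= `|g x|]); first exact: g0.1.2.
by apply/seteqP; split => x /=; rewrite ger0_norm// g0.2.
Qed.

Definition cut (U : set X) f : X -> R := fun x => if x \in U then f x else 0.

(** At a point outside both open sets [f] vanishes, so continuity of the cut there
    follows from that of [f]. *)
Lemma cut_continuous (U V : set X) f : open U -> open V -> U `&` V = set0 ->
  continuous f -> (forall x, ~ U x -> ~ V x -> f x = 0) ->
  continuous (cut U f).
Proof.
move=> oU oV UV0 cf f0 x.
have [Ux|nUx] := pselect (U x).
  apply: (@cvg_trans _ (f @ x)); last by rewrite /cut mem_set//; exact: cf.
  apply: near_eq_cvg; have : \forall y \near x, U y by exact: open_nbhs_nbhs.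
  by apply: filterS => y Uy; rewrite /cut mem_set.
rewrite /continuous_at {2}/cut memNset//.
have [Vx|nVx] := pselect (V x).
  apply: (@cvg_trans _ (cst (0:R) @ x)); last exact: cvg_cst.
  apply: near_eq_cvg; have : \forall y \near x, V y by exact: open_nbhs_nbhs.
  apply: filterS => y Vy; rewrite /cut memNset// => Uy.
  by have : set0 y by rewrite -UV0.
apply/cvgrPdist_le => e e0.
have /cvgrPdist_le /(_ e e0) := cf x; rewrite f0//.
apply: filterS => y; rewrite !sub0r !normrN /cut; case: ifPn => // _ _.
by rewrite normr0 ltW.
Qed.

Lemma cut_C0 (U V : set X) f : open U -> open V -> U `&` V = set0 ->
  C0 R X f -> (forall x, ~ U x -> ~ V x -> f x = 0) -> C0 R X (cut U f).
Proof.
move=> oU oV UV0 f0 fUV; apply: (@C0_dom1 f _ 1 f0).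
  by apply: (cut_continuous oU oV UV0 _ fUV); exact: f0.1.
by move=> x; rewrite mul1r /cut; case: ifPn => // _; rewrite normr0.
Qed.

End C0_theory.

(** The one-point compactification is normal, and a neighbourhood of the point at
    infinity contains the complement of a compact set; since the Urysohn function
    vanishes at infinity, its restriction to [X] is in [C0]. *)
Lemma urysohn_C0plus (R : realType) (X : ptopologicalType) (K U : set X) :
  locally_compact [set: X] -> hausdorff_space X ->
  compact K -> open U -> K `<=` U ->
  exists f : X -> R, [/\ C0plus R X f, forall x, f x <= 1,
    forall x, K x -> f x = 1 & forall x, ~ U x -> f x = 0].
Proof.
move=> lcX hX cK oU KU.
pose opc := one_point_compactification X.
have hopc : hausdorff_space opc by exact: one_point_compactification_hausdorff.
have nopc : normal_space opc.
  by apply: compact_normal => //; exact: one_point_compactification_compact.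
pose A : set opc := Some @` K.
pose B : set opc := ~` (Some @` U).
have cA : closed A.
  apply: compact_closed => //; apply: continuous_compact => //.
  by apply: continuous_subspaceT; exact: one_point_compactification_some_continuous.
have cB : closed B.
  by apply: open_closedC; exact: one_point_compactification_open_some.
have AB : B `&` A = set0.
  rewrite -subset0 => z [nU [x Kx xz]]; apply: nU; exists x => //; exact: KU.
have /(uniform_separatorP (R := R)) [f [cf f01 fB fA]] :=
  normal_uniform_separator nopc cB cA AB.
have fge0 z : 0 <= f z <= 1.
  by have := f01 (f z); rewrite /= in_itv/=; apply; exists z.
have fN : f None = 0 by apply: fB; exists None => //= -[].
pose g x := f (Some x).
have cg : continuous g.
  move=> x; apply: (@continuous_comp X opc R Some f x); last exact: cf.
  exact: one_point_compactification_some_continuous.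
exists g; split.
- split; last by move=> x; case/andP: (fge0 (Some x)).
  split => // e e0.
  have /cvgrPdist_lt /(_ e e0) [C [cC clC] CN] := cf None.
  apply: (subclosed_compact _ cC).
    by apply: closed_superlevel; exact: continuous_normf.
  move=> x /= ex; apply: contrapT => nCx.
  have /CN /= : ((Some @` (~` C)) `|` [set None]) (Some x) by left; exists x.
  by rewrite fN sub0r normrN => /(le_lt_trans ex); rewrite ltxx.
- by move=> x; case/andP: (fge0 (Some x)).
- by move=> x Kx; apply: fA; exists (Some x) => //; exists x.
- by move=> x nUx; apply: fB; exists (Some x) => //= -[y Uy [yx]]; apply: nUx; rewrite -yx.
Qed.

(** * Deficient topological measures *)

Section DTM_theory.
Context {R : realType} {X : ptopologicalType}.
Hypothesis hX : hausdorff_space X.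
Implicit Types (mu nu : set X -> \bar R) (A B C K F U V : set X) (f g : X -> R).
Local Open Scope ereal_scope.

Lemma DTM_ge0 mu A : DTM R X mu -> 0 <= mu A.
Proof.
move=> [[mu0 _ _ _] _ muz]; have [oA|nA] := pselect (open_or_closed A).
  exact: mu0.
by rewrite muz.
Qed.

Lemma DTM_le mu A B : DTM R X mu -> open_or_closed A -> open_or_closed B ->
  A `<=` B -> mu A <= mu B.
Proof.
move=> [[_ _ iro orc] _ _] oA [oB|cB] AB.
  case: oA => [oA|cA]; first exact: le_open.
  by rewrite (orc _ cA); apply: ereal_inf_lbound; exists B.
rewrite (orc _ cB); apply: le_ereal_inf_tmp => _ [U [oU BU] <-].
have AU : A `<=` U by exact: subset_trans BU.
case: oA => [oA|cA]; first exact: le_open.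
by rewrite (orc _ cA); apply: ereal_inf_lbound; exists U.
Qed.

Lemma DTM_leT mu A : DTM R X mu -> mu A <= mu setT.
Proof.
move=> muD; have [oA|nA] := pselect (open_or_closed A).
  by apply: (DTM_le muD) => //; left; exact: openT.
have [_ _ muz] := muD; rewrite (muz _ nA); exact: DTM_ge0.
Qed.

Lemma DTM_fin mu A : DTM R X mu -> mu A \is a fin_num.
Proof.
move=> muD; rewrite ge0_fin_numE ?DTM_ge0//.
by apply: le_lt_trans (DTM_leT A muD) _; case: muD.
Qed.

Lemma DTM_set0 mu : DTM R X mu -> mu set0 = 0.
Proof.
move=> muD; have [[_ muU _ _] _ _] := muD.
have := muU set0 set0 compact0 compact0 (setI0 _); rewrite setU0.
move: (DTM_fin set0 muD); case: (mu set0) => // r _ [] /eqP.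
by rewrite -[X in (X == _)%R]addr0 (inj_eq (addrI _)) => /eqP <-.
Qed.

Lemma compact_oc K : compact K -> open_or_closed K.
Proof. by move=> cK; right; exact: compact_closed. Qed.

Lemma DTM_inner mu U (e : R) : DTM R X mu -> open U -> (0 < e)%R ->
  exists K, [/\ compact K, K `<=` U & mu U <= mu K + e%:E].
Proof.
move=> muD oU e0; have := DTM_fin U muD.
have [[_ _ iro _] _ _] := muD; rewrite (iro _ oU) => fU.
have [_ [K [cK KU] <-]] := ub_ereal_sup_adherent e0 fU.
by rewrite -(iro _ oU) => /ltW muK; exists K; split => //; rewrite -leeBlDr.
Qed.

Lemma DTM_outer mu F (e : R) : DTM R X mu -> closed F -> (0 < e)%R ->
  exists U, [/\ open U, F `<=` U & mu U <= mu F + e%:E].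
Proof.
move=> muD cF e0; have := DTM_fin F muD.
have [[_ _ _ orc] _ _] := muD; rewrite (orc _ cF) => fF.
have [_ [U [oU FU] <-]] := lb_ereal_inf_adherent e0 fF.
by rewrite -(orc _ cF) => /ltW muU; exists U.
Qed.

(** Approximating both sets from inside by disjoint compact sets turns additivity
    on compact sets into superadditivity. *)
Lemma DTM_super mu A B D : DTM R X mu -> compact_or_open A ->
  compact_or_open B -> open_or_closed D -> A `&` B = set0 -> A `<=` D ->
  B `<=` D -> mu A + mu B <= mu D.
Proof.
move=> muD; have inn E (e : R) : compact_or_open E -> (0 < e)%R ->
    exists K, [/\ compact K, K `<=` E & mu E <= mu K + e%:E].
  move=> [cE e0|oE e0]; last exact: DTM_inner.
  by exists E; split => //; rewrite leeDl// lee_fin ltW.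
move=> cA cB oD AB0 AD BD; apply/lee_addgt0Pr => e e0.
have e20 : (0 < e / 2)%R by rewrite divr_gt0.
have [K [cK KA muK]] := inn _ _ cA e20.
have [L [cL LB muL]] := inn _ _ cB e20.
apply: le_trans (leeD muK muL) _.
rewrite addeACA -EFinD -splitr leeD2r//.
have [[_ muU _ _] _ _] := muD.
rewrite -muU//; last first.
  by rewrite -subset0 -AB0 => x [/KA ? /LB].
apply: DTM_le => //; first by apply: compact_oc; exact: compactU.
by move=> x [/KA/AD|/LB/BD].
Qed.

(** A compact subset of a union of two disjoint open sets splits into two compact
    sets, one in each of them. *)
Lemma DTM_openU mu U V : DTM R X mu -> open U -> open V ->
  U `&` V = set0 -> mu (U `|` V) = mu U + mu V.
Proof.
move=> muD oU oV UV0; apply/eqP; rewrite eq_le; apply/andP; split; last first.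
  apply: DTM_super => //; try by right.
  by left; exact: openU.
have [[_ muA iro _] _ _] := muD.
rewrite {1}(iro _ (openU oU oV)); apply: ge_ereal_sup => _ [K [cK KUV] <-].
have cKU : compact (K `&` U).
  have -> : K `&` U = K `\` V.
    apply/seteqP; split => x [Kx]; last by case: (KUV _ Kx).
    by move=> Ux; split => // Vx; have : set0 x by rewrite -UV0.
  apply: (subclosed_compact _ cK); last exact: subIsetl.
  by apply: closedI; [exact: compact_closed|exact: open_closedC].
have cKV : compact (K `&` V).
  have -> : K `&` V = K `\` U.
    apply/seteqP; split => x [Kx]; last by case: (KUV _ Kx).
    by move=> Ux; split => // Vx; have : set0 x by rewrite -UV0.
  apply: (subclosed_compact _ cK); last exact: subIsetl.
  by apply: closedI; [exact: compact_closed|exact: open_closedC].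
have -> : K = (K `&` U) `|` (K `&` V) by rewrite -setIUr; apply/esym/setIidl.
rewrite muA//; last by rewrite setIACA UV0 setI0.
apply: leeD; apply: DTM_le => //; try exact: compact_oc; by left.
Qed.

(** Regularity of a combination holds because compact sets approximating from
    inside can be joined and open sets approximating from outside can be intersected,
    so that one set serves for both [mu] and [nu]. *)
Lemma conic_comb_DTM (c d : R) mu nu : (0 <= c)%R -> (0 <= d)%R ->
  DTM R X mu -> DTM R X nu -> DTM R X (conic_comb c d mu nu).
Proof.
move=> c0 d0 muD nuD.
have [m fm] : exists m : set X -> R, forall A, mu A = (m A)%:E.
  by exists (fun A => fine (mu A)) => A; rewrite fineK// DTM_fin.
have [n fn] : exists n : set X -> R, forall A, nu A = (n A)%:E.
  by exists (fun A => fine (nu A)) => A; rewrite fineK// DTM_fin.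
have mono A B : open_or_closed A -> open_or_closed B -> A `<=` B ->
    conic_comb c d mu nu A <= conic_comb c d mu nu B.
  by move=> oA oB AB; rewrite /conic_comb leeD// lee_wpmul2l ?lee_fin// DTM_le.
have comb_le A B (e : R) : mu A <= mu B + e%:E -> nu A <= nu B + e%:E ->
    conic_comb c d mu nu A <= conic_comb c d mu nu B + ((c + d) * e)%:E.
  rewrite /conic_comb !fm !fn -!EFinM -!EFinD !lee_fin => h1 h2.
  have := ler_wpM2l c0 h1; have := ler_wpM2l d0 h2; lra.
have fc A : conic_comb c d mu nu A \is a fin_num.
  by rewrite /conic_comb fm fn.
have slack (e : R) : (0 < e)%R -> exists2 e' : R, (0 < e')%R & ((c + d) * e' <= e)%R.
  move=> e0; have cd : (0 < c + d + 1)%R by rewrite ltr_wpDl// addr_ge0.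
  exists (e / (c + d + 1))%R; first by rewrite divr_gt0.
  by rewrite mulrA ler_pdivrMr// mulrC ler_pM2l// lerDl.
split.
- split.
  + by move=> A _; rewrite /conic_comb adde_ge0// mule_ge0 ?lee_fin ?DTM_ge0.
  + move=> C K cC cK CK0; have [[_ muA _ _] _ _] := muD.
    have [[_ nuA _ _] _ _] := nuD.
    rewrite /conic_comb muA// nuA// !fm !fn -!EFinM -!EFinD; congr _%:E; ring.
  + move=> U oU; apply/eqP; rewrite eq_le; apply/andP; split; last first.
      apply: ge_ereal_sup => _ [K [cK KU] <-]; apply: mono => //; last by left.
      exact: compact_oc.
    apply/lee_addgt0Pr => e e0; have [e' e'0 e'e] := slack _ e0.
    have [K [cK KU muK]] := DTM_inner muD oU e'0.
    have [L [cL LU nuL]] := DTM_inner nuD oU e'0.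
    apply: (@le_trans _ _ (conic_comb c d mu nu (K `|` L) + ((c + d) * e')%:E)).
      apply: comb_le; [apply: (le_trans muK)|apply: (le_trans nuL)];
        rewrite leeD2r// DTM_le//; try exact: compact_oc;
        by apply: compact_oc; exact: compactU.
    apply: leeD; last by rewrite lee_fin.
    apply: ereal_sup_ubound; exists (K `|` L) => //; split; first exact: compactU.
    by move=> x [/KU|/LU].
  + move=> F cF; apply/eqP; rewrite eq_le; apply/andP; split.
      apply: le_ereal_inf_tmp => _ [U [oU FU] <-]; apply: mono => //; last by left.
      by right.
    apply/lee_addgt0Pr => e e0; have [e' e'0 e'e] := slack _ e0.
    have [U [oU FU muU]] := DTM_outer muD cF e'0.
    have [V [oV FV nuV]] := DTM_outer nuD cF e'0.
    have oUV : open_or_closed (U `&` V) by left; exact: openI.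
    apply: (@le_trans _ _ (conic_comb c d mu nu (U `&` V))).
      apply: ereal_inf_lbound; exists (U `&` V) => //; split; first exact: openI.
      by move=> x Fx; split; [exact: FU|exact: FV].
    apply: (@le_trans _ _ (conic_comb c d mu nu F + ((c + d) * e')%:E)); last first.
      by rewrite leeD2l// lee_fin.
    apply: comb_le.
      by apply: (le_trans _ muU); apply: DTM_le => //; left.
    by apply: (le_trans _ nuV); apply: DTM_le => //; left.
- by rewrite ltey_eq fc.
- move=> A nA; have [_ _ muz] := muD; have [_ _ nuz] := nuD.
  by rewrite /conic_comb muz// nuz// !mule0 adde0.
Qed.

End DTM_theory.

(** * The layer cake formula *)

Section layer_cake.
Local Open Scope ereal_scope.
Context {d} {T : measurableType d} {R : realType}.

(** Tonelli for the region under the graph of [psi]. *)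
Lemma layer_cake (m : {measure set T -> \bar R}) (psi : T -> R) :
  m setT < +oo -> measurable_fun setT psi -> (forall x, 0 <= psi x)%R ->
  \int[m]_x (psi x)%:E =
  \int[@lebesgue_measure R]_(t in `[0%R, +oo[) m [set x | (t < psi x)%R].
Proof.
move=> mT mpsi psi0.
have mfin : fin_num_fun m.
  move=> A mA; rewrite ge0_fin_numE//.
  by apply: le_lt_trans mT; apply: le_measure; rewrite ?inE.
have sgf : sigma_finite setT m.
  by apply: fin_num_fun_sigma_finite => //; rewrite measure0.
pose m' : {finite_measure set T -> \bar R} :=
  let H1 := @isSFinite.Build _ T R m (sfinite_measure_sigma_finite sgf) in
  let H2 := @isSigmaFinite.Build _ T R m sgf in
  let H3 := @isFinite.Build _ T R m mfin in
  HB.pack_for (FiniteMeasure.type T R) (Measure.sort m) H1 H2 H3.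
pose S : set (T * measurableTypeR R) := [set p | (0 <= p.2)%R && (p.2 < psi p.1)%R].
have mS : measurable S.
  have -> : S = (fun p : T * measurableTypeR R => (0 <= p.2)%R) @^-1` [set true] `&`
      (fun p : T * measurableTypeR R => (p.2 < psi p.1)%R) @^-1` [set true].
    by apply/seteqP; split => p /=; [move/andP|move=> h; apply/andP].
  apply: measurableI.
  - have : measurable_fun setT (fun p : T * measurableTypeR R => (0 <= p.2)%R).
      by apply: measurable_fun_ler.
    by move=> /(_ measurableT [set true]); rewrite setTI; exact.
  - have : measurable_fun setT (fun p : T * measurableTypeR R => (p.2 < psi p.1)%R).
      by apply: measurable_fun_ltr => //; exact: measurableT_comp.
    by move=> /(_ measurableT [set true]); rewrite setTI; exact.
have mlt t : measurable [set x | (t < psi x)%R].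
  have : measurable_fun setT (fun x => (t < psi x)%R) by exact: measurable_fun_ltr.
  move=> /(_ measurableT [set true]); rewrite setTI.
  have -> : (fun x => (t < psi x)%R) @^-1` [set true] = [set x | (t < psi x)%R].
    by apply/seteqP; split.
  by apply.
transitivity (\int[m]_x \int[@lebesgue_measure R]_t (\1_S (x, t))%:E).
  apply: eq_integral => x _.
  transitivity (\int[@lebesgue_measure R]_t (\1_(`[0%R, psi x[%classic) t)%:E).
    rewrite integral_indic// setIT/= lebesgue_measure_itv/= lte_fin.
    have [|] := ltP 0%R (psi x); first by rewrite sube0.
    by move=> px; congr _%:E; apply/eqP; rewrite eq_le px psi0.
  apply: eq_integral => t _; rewrite !indicE.
  suff -> : (t \in `[0%R, psi x[%classic) = ((x, t) \in S) by [].
  by apply/idP/idP; rewrite !inE/= ?in_itv/=.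
transitivity (\int[@lebesgue_measure R]_t \int[m]_x (\1_S (x, t))%:E).
  apply: (@fubini_tonelli _ _ T (measurableTypeR R) R m' lebesgue_measure
    (fun p => (\1_S p)%:E)).
    exact/measurable_EFinP/measurable_indic.
  by move=> p; rewrite lee_fin.
rewrite [RHS]integral_mkcond; apply: eq_integral => t _; rewrite patchE.
have [t0|t0] := leP 0%R t.
  rewrite mem_set/= ?in_itv/= ?t0//.
  rewrite -[X in m X]setIT -(integral_indic m measurableT (mlt t)).
  apply: eq_integral => x _; rewrite !indicE.
  suff -> : ((x, t) \in S) = (x \in [set x | (t < psi x)%R]) by [].
  by apply/idP/idP; rewrite !inE/=; [case/andP|rewrite /S/= t0].
rewrite memNset/= ?in_itv/= ?leNgt ?t0//; apply: integral0_eq => x _.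
by rewrite indicE memNset//= /S/= leNgt t0.
Qed.

End layer_cake.

(** * The Stieltjes measure of a function *)

Section stieltjes_measure_of_a_function.
Local Open Scope ereal_scope.
Context {R : realType}.

Lemma ex_nat_gt (x : R) : exists n : nat, (x < n%:R)%R.
Proof.
exists (Num.bound `|x|); apply: le_lt_trans (ler_norm x) _.
exact: archi_boundP.
Qed.

Lemma ls_measure_ocitv (F : R -> R) (a b : R) : is_cumulative F -> (a <= b)%R ->
  ls_measure F `]a, b]%classic = (F b - F a)%:E.
Proof.
move=> cF ab.
pose C := HB.pack_for (cumulative R R) F (isCumulative.Build R _ R F cF.1 cF.2).
rewrite -[ls_measure F]/(ls_measure C) (ls_measureE C).
rewrite /lebesgue_stieltjes_measure /measure_extension measurable_mu_extE/=; last first.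
  exact: is_ocitv.
by rewrite wlength_itv_bnd.
Qed.

Context {X : ptopologicalType}.
Hypothesis hX : hausdorff_space X.
Variables (mu : set X -> \bar R) (f : X -> R) (M : R).
Hypotheses (muD : DTM R X mu) (cf : continuous f) (fM : forall x, (`|f x| <= M)%R).

Let r := ls_measure (fun t => - R1 mu f t)%R.

Let fin (t : R) : (R1 mu f t)%:E = mu (f @^-1` `]t, +oo[).
Proof. by rewrite /R1 fineK// (DTM_fin _ muD). Qed.

Lemma preimage_ray (t : R) : f @^-1` `]t, +oo[ = [set x | (t < f x)%R].
Proof. by apply/seteqP; split => x /=; rewrite in_itv/= andbT. Qed.

(** The bound on [f] makes [R1 mu f] vanish far to the right. *)
Lemma ls_ray (a : R) : r `]a, +oo[%classic = mu (f @^-1` `]a, +oo[).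
Proof.
have cum := is_cumulative_opp_R1 muD cf.
pose F n : set (measurableTypeR R) := `]a, (a + n%:R)%R]%classic.
have FE : `]a, +oo[%classic = \bigcup_n F n.
  apply/seteqP; split => x /=; rewrite in_itv/= andbT.
    move=> ax; have [n /ltW xn] := ex_nat_gt (x - a).
    by exists n => //=; rewrite /F/= in_itv/= ax/= -lerBlDl.
  by move=> [n _] /=; rewrite /F/= in_itv/= => /andP[].
have c1 : r \o F @ \oo --> r (\bigcup_n F n).
  apply: nondecreasing_cvg_mu => //.
  - by move=> n; exact: measurable_itv.
  - by apply: bigcup_measurable => n _; exact: measurable_itv.
  - move=> m n mn; apply/subsetPset => x; rewrite /F/= !in_itv/= => /andP[->/=].
    by move/le_trans; apply; rewrite lerD2l ler_nat.
have c2 : r \o F @ \oo --> mu (f @^-1` `]a, +oo[).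
  have [N /ltW MN] := ex_nat_gt (M - a).
  apply: cvg_near_cst; exists N => // n /= Nn.
  rewrite /r/= ls_measure_ocitv// ?lerDl// opprK -fin.
  suff -> : R1 mu f (a + n%:R) = 0%R by rewrite oppr0 add0r.
  rewrite /R1 (_ : _ @^-1` _ = set0) ?(DTM_set0 muD)//.
  rewrite preimage_ray -subset0 => x /= /lt_le_trans/(_ (le_trans (ler_norm _) (fM x))).
  by rewrite -ltrBrDl ltNge (le_trans MN)// ler_nat.
rewrite [in LHS]FE; exact: (cvg_unique (@ereal_hausdorff R) c1 c2).
Qed.

Lemma ls_setT : r setT = mu setT.
Proof.
pose F n : set (measurableTypeR R) := `](- n%:R)%R, +oo[%classic.
have FE : setT = \bigcup_n F n.
  apply/seteqP; split => x //= _; have [n xn] := ex_nat_gt (- x).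
  by exists n => //=; rewrite /F/= in_itv/= andbT ltrNl.
have c1 : r \o F @ \oo --> r (\bigcup_n F n).
  apply: nondecreasing_cvg_mu => //.
  - by move=> n; exact: measurable_itv.
  - by apply: bigcup_measurable => n _; exact: measurable_itv.
  - move=> m n mn; apply/subsetPset => x; rewrite /F/= !in_itv/= !andbT.
    by apply: le_lt_trans; rewrite lerN2 ler_nat.
have c2 : r \o F @ \oo --> mu setT.
  have [N MN] := ex_nat_gt M.
  apply: cvg_near_cst; exists N => // n /= Nn; rewrite ls_ray; congr (mu _).
  rewrite preimage_ray; apply/seteqP; split => x //= _.
  rewrite ltrNl (lt_le_trans (le_lt_trans _ MN)) ?ler_nat//.
  by rewrite (le_trans _ (fM x))// -normrN ler_norm.
rewrite [in LHS]FE; exact: (cvg_unique (@ereal_hausdorff R) c1 c2).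
Qed.

Lemma ls_rayE (a : R) : r `]a, +oo[%classic = mu [set x | (a < f x)%R].
Proof. by rewrite ls_ray preimage_ray. Qed.

(** Stieltjes mass is carried by the half-lines that contain the range. *)
Lemma ls_lt0 (c : R) : (forall x, c <= f x)%R -> r `]-oo, c[%classic = 0.
Proof.
move=> f0.
have r0 (a : R) : (a < c)%R -> r `]-oo, a]%classic = 0.
  move=> a0; have : r (`]-oo, a] `|` `]a, +oo[) = r `]-oo, a]%classic + r `]a, +oo[%classic.
    apply: measureU; [exact: measurable_itv..|].
    by rewrite -subset0 => x /= []; rewrite !in_itv/= andbT leNgt => /negbTE ->.
  have -> : `]-oo, a] `|` `]a, +oo[ = [set: R].
    apply/seteqP; split => x //= _; rewrite !in_itv/= andbT.
    by have [|] := leP x a; [left|right].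
  have aT : [set x | (a < f x)%R] = setT.
    by apply/seteqP; split => x //= _; exact: lt_le_trans (f0 x).
  rewrite ls_rayE aT ls_setT => E.
  by rewrite -[LHS](addeK _ (DTM_fin setT muD)) -E subee// DTM_fin.
pose F n : set (measurableTypeR R) := `]-oo, (c - n.+1%:R^-1)%R]%classic.
have FE : `]-oo, c[%classic = \bigcup_n F n.
  apply/seteqP; split => x /=; last first.
    by move=> [n _]; rewrite /F/= !in_itv/= => /le_lt_trans; apply; rewrite gtrDl oppr_lt0.
  rewrite in_itv/= => x0; have [n xn] := ex_nat_gt (c - x)^-1.
  exists n => //=; rewrite /F/= in_itv/= lerBrDr -lerBrDl.
  rewrite -[leRHS]invrK lef_pV2 ?posrE ?invr_gt0 ?subr_gt0//.
  by rewrite (le_trans (ltW xn))// ler_nat.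
have c1 : r \o F @ \oo --> r (\bigcup_n F n).
  apply: nondecreasing_cvg_mu => //.
  - by move=> n; exact: measurable_itv.
  - by apply: bigcup_measurable => n _; exact: measurable_itv.
  - move=> m n mn; apply/subsetPset => x; rewrite /F/= !in_itv/=.
    by move/le_trans; apply; rewrite lerD2l lerN2 lef_pV2 ?posrE// ler_nat.
have c2 : r \o F @ \oo --> 0.
  apply: cvg_near_cst; exists 0%N => // n _ /=; apply: r0.
  by rewrite gtrDl oppr_lt0.
by rewrite [in LHS]FE; exact: (cvg_unique (@ereal_hausdorff R) c1 c2).
Qed.

End stieltjes_measure_of_a_function.

Section layer_cake_for_Pi.
Local Open Scope ereal_scope.
Context {R : realType} {X : ptopologicalType}.
Implicit Types (mu : set X -> \bar R) (f g : X -> R).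
Local Notation leb := (@lebesgue_measure R).

(** Since [f >= 0], the negative half-line is a null set; the identity may thus be
    replaced by its positive part, to which the layer cake formula applies. *)
Lemma Pi_tail mu f : DTM R X mu -> C0plus R X f ->
  Pi mu f = \int[leb]_(t in `[0%R, +oo[) mu [set x | (t < f x)%R].
Proof.
move=> muD [fC f0]; have [M M0 fM] := C0_bounded fC.
have cf := fC.1.
rewrite /Pi patchE mem_set// /Rfun.
set r := ls_measure _.
have mmax : measurable_fun [set: measurableTypeR R] (fun t : measurableTypeR R => Order.max t 0%R).
  by apply: measurable_maxr.
transitivity (\int[r]_t (Order.max t 0%R)%:E).
  apply: ae_eq_integral => //; [exact/measurable_EFinP..|].
  exists `]-oo, 0%R[%classic; split; first exact: measurable_itv.
    exact: (ls_lt0 muD cf fM).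
  move=> t /=; apply: contra_notP; rewrite in_itv/= => /negP; rewrite -leNgt => t0 _.
  by rewrite max_l.
rewrite layer_cake//.
- apply: eq_integral => t; rewrite inE/= in_itv/= andbT => t0.
  rewrite -(ls_rayE muD cf fM); congr (_ _); apply/seteqP; split => s /=;
    by rewrite in_itv/= andbT lt_max [X in _ || X]ltNge t0/= orbF.
- by rewrite /r (ls_setT muD cf fM); case: muD.
- by move=> t; rewrite le_max lexx orbT.
Qed.

(** The transport principle: [Pi mu g] depends on the tails of [g] only, so it
    may be computed on any finite measure space carrying a function with these tails. *)
Lemma Pi_layer {d} {T : measurableType d} (m : {measure set T -> \bar R})
    (psi : T -> R) mu g : DTM R X mu -> C0plus R X g ->
  m setT < +oo -> measurable_fun setT psi -> (forall x, 0 <= psi x)%R ->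
  (forall t, (0 <= t)%R -> m [set x | (t < psi x)%R] = mu [set x | (t < g x)%R]) ->
  Pi mu g = \int[m]_x (psi x)%:E.
Proof.
move=> muD g0 mT mpsi psi0 E; rewrite Pi_tail// layer_cake//.
by apply: eq_integral => t; rewrite inE/= in_itv/= andbT => /E.
Qed.

End layer_cake_for_Pi.

(** * Estimates, order, norm and conic combinations *)

Section Pi_bounds.
Local Open Scope ereal_scope.
Context {R : realType} {X : ptopologicalType}.
Hypothesis hX : hausdorff_space X.
Implicit Types (mu nu : set X -> \bar R) (f g : X -> R) (A U W : set X).
Local Notation leb := (@lebesgue_measure R).
Local Notation pos := (`[0%R, +oo[%classic : set (measurableTypeR R)).

Let mpos : measurable pos. Proof. exact: measurable_itv. Qed.

Lemma superlevel_oc f (t : R) : continuous f -> open_or_closed [set x | (t < f x)%R].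
Proof. by move=> cf; left; exact: open_superlevel. Qed.

Lemma measurable_tail mu f D : DTM R X mu -> continuous f ->
  measurable D ->
  measurable_fun D (fun t : measurableTypeR R => mu [set x | (t < f x)%R]).
Proof.
move=> muD cf mD.
rewrite (_ : (fun _ => _) = EFin \o (fun t => fine (mu [set x | (t < f x)%R]))); last first.
  by apply/funext => t /=; rewrite fineK// (DTM_fin _ muD).
apply/measurable_EFinP; apply: nonincreasing_measurable => // s t st.
rewrite fine_le ?(DTM_fin _ muD)//; apply: (DTM_le muD).
- exact: superlevel_oc.
- exact: superlevel_oc.
- by move=> x /=; exact: le_lt_trans.
Qed.

Lemma Pi_out mu f : ~ C0plus R X f -> Pi mu f = 0.
Proof. by move=> nf; rewrite /Pi patchE memNset. Qed.

Lemma Pi_ge0 mu f : DTM R X mu -> 0 <= Pi mu f.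
Proof.
move=> muD; have [f0|nf] := pselect (C0plus R X f); last by rewrite Pi_out.
by rewrite Pi_tail//; apply: integral_ge0 => t _; exact: DTM_ge0.
Qed.

Lemma Pi_le2 mu nu f g : DTM R X mu -> DTM R X nu ->
  C0plus R X f -> C0plus R X g ->
  (forall t, (0 <= t)%R -> mu [set x | (t < f x)%R] <= nu [set x | (t < g x)%R]) ->
  Pi mu f <= Pi nu g.
Proof.
move=> muD nuD f0 g0 fg; rewrite !Pi_tail//.
apply: ge0_le_integral => //; try by move=> *; exact: DTM_ge0.
- by apply: measurable_tail => //; exact: f0.1.1.
- by apply: measurable_tail => //; exact: g0.1.1.
- by move=> t; rewrite /= in_itv/= andbT; exact: fg.
Qed.

Lemma Pi_mono mu f g : DTM R X mu -> C0plus R X f -> C0plus R X g ->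
  (forall x, f x <= g x)%R -> Pi mu f <= Pi mu g.
Proof.
move=> muD f0 g0 fg; apply: Pi_le2 => // t _; apply: (DTM_le muD).
- by apply: superlevel_oc; exact: f0.1.1.
- by apply: superlevel_oc; exact: g0.1.1.
- by move=> x /= /lt_le_trans; apply.
Qed.

(** The estimates below compare tails with boxes of width [c] and height [k]. *)
Lemma integral_box (k : \bar R) (c : R) : 0 <= k -> (0 <= c)%R ->
  \int[leb]_(t in pos) (k * (\1_(`[0%R, c[%classic) t)%:E) = k * c%:E.
Proof.
move=> k0 c0; rewrite ge0_integralZl//=.
- rewrite integral_indic//= setIidl; last first.
    by move=> t /=; rewrite !in_itv/= andbT => /andP[].
  rewrite lebesgue_measure_itv/= lte_fin.
  by move: c0; rewrite le_eqVlt => /predU1P[<-|->]; rewrite ?ltxx ?sube0.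
- by apply/measurable_EFinP; exact: measurable_indic.
Qed.

(** The tail of [f] is at most [mu setT] below height [e], at most [mu W] between [e]
    and 1, and zero above 1. *)
Lemma Pi_le_open mu f W (e : R) : DTM R X mu -> C0plus R X f -> open W ->
  (0 <= e)%R -> (forall x, f x <= 1)%R -> (forall x, ~ W x -> f x <= e)%R ->
  Pi mu f <= e%:E * mu setT + mu W.
Proof.
move=> muD f0 oW e0 f1 fW; rewrite Pi_tail//.
have mbox (k : \bar R) c : 0 <= k ->
    measurable_fun pos (fun t : measurableTypeR R => k * (\1_(`[0%R, c[%classic) t)%:E).
  move=> k0; apply: measurable_funeM.
  by apply/measurable_EFinP; exact: measurable_indic.
have -> : e%:E * mu setT + mu W = \int[leb]_(t in pos)
    (mu setT * (\1_(`[0%R, e[%classic) t)%:E + mu W * (\1_(`[0%R, 1%R[%classic) t)%:E).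
  rewrite ge0_integralD//=.
  - by rewrite !integral_box ?(DTM_ge0 _ muD)// mule1 muleC.
  - by move=> t _; rewrite mule_ge0 ?(DTM_ge0 _ muD) ?lee_fin//.
  - by apply: mbox; exact: DTM_ge0.
  - by move=> t _; rewrite mule_ge0 ?(DTM_ge0 _ muD) ?lee_fin//.
  - by apply: mbox; exact: DTM_ge0.
apply: ge0_le_integral => //=.
- by move=> t _; exact: DTM_ge0.
- by apply: measurable_tail => //; exact: f0.1.1.
- by apply: emeasurable_funD; apply: mbox; exact: DTM_ge0.
- move=> t; rewrite in_itv/= andbT => t0.
  have [te|et] := ltP t e.
    have -> : (\1_(`[0%R, e[%classic) t)%:E = 1 :> \bar R.
      by rewrite indicE mem_set//= in_itv/= t0.
    rewrite mule1 (le_trans (DTM_leT _ muD))// leeDl// mule_ge0 ?(DTM_ge0 _ muD)//.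
  have -> : (\1_(`[0%R, e[%classic) t)%:E = 0 :> \bar R.
    by rewrite indicE memNset//= in_itv/= t0/= ltNge et.
  rewrite mule0 add0e.
  have [t1|t1] := ltP t 1%R.
    rewrite indicE mem_set/= ?in_itv/= ?t0// mule1; apply: (DTM_le muD).
    - by apply: superlevel_oc; exact: f0.1.1.
    - by left.
    - by move=> x /= tf; apply: contrapT => /fW; rewrite leNgt (le_lt_trans et).
  rewrite (_ : [set x | _] = set0) ?(DTM_set0 muD) ?mule_ge0 ?(DTM_ge0 _ muD) ?lee_fin//.
  by rewrite -subset0 => x /= /lt_le_trans /(_ (f1 x)); rewrite ltNge t1.
Qed.

Lemma Pi_ge_on mu f A (c : R) : DTM R X mu -> C0plus R X f ->
  open_or_closed A -> (0 <= c)%R -> (forall x, A x -> c <= f x)%R ->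
  c%:E * mu A <= Pi mu f.
Proof.
move=> muD f0 oA c0 fA; rewrite Pi_tail// muleC -integral_box ?(DTM_ge0 _ muD)//.
apply: ge0_le_integral => //=.
- by move=> t _; rewrite mule_ge0 ?(DTM_ge0 _ muD) ?lee_fin//.
- apply: measurable_funeM.
  by apply/measurable_EFinP; exact: measurable_indic.
- by apply: measurable_tail => //; exact: f0.1.1.
- move=> t; rewrite in_itv/= andbT => t0.
  have [tc|ct] := ltP t c.
    rewrite indicE mem_set/= ?in_itv/= ?t0// mule1; apply: (DTM_le muD) => //.
      by apply: superlevel_oc; exact: f0.1.1.
    by move=> x /fA; exact: lt_le_trans.
  by rewrite indicE memNset/= ?in_itv/= ?t0/= ?ltNge ?ct// mule0; exact: DTM_ge0.
Qed.

Lemma Pi_le_supp mu f U : DTM R X mu -> C0plus R X f -> open U ->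
  (forall x, f x <= 1)%R -> (forall x, ~ U x -> f x = 0)%R -> Pi mu f <= mu U.
Proof.
move=> muD f0 oU f1 fU; have := Pi_le_open muD f0 oU (lexx 0%R) f1.
by rewrite mul0e add0e; apply => x /fU ->.
Qed.

Lemma Pi_ge_supp mu f A : DTM R X mu -> C0plus R X f -> open_or_closed A ->
  (forall x, A x -> 1 <= f x)%R -> mu A <= Pi mu f.
Proof. by move=> muD f0 oA f1; rewrite -[leLHS]mul1e; exact: Pi_ge_on. Qed.

Lemma Pi_conic (c d : R) mu nu : (0 <= c)%R -> (0 <= d)%R -> DTM R X mu ->
  DTM R X nu -> Pi (conic_comb c d mu nu) = conic_comb c d (Pi mu) (Pi nu).
Proof.
move=> c0 d0 muD nuD; have cD := conic_comb_DTM hX c0 d0 muD nuD.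
apply/funext => f; rewrite {2}/conic_comb.
have [f0|nf] := pselect (C0plus R X f); last by rewrite !Pi_out// !mule0 adde0.
rewrite !Pi_tail//.
have mt m : DTM R X m -> measurable_fun pos (fun t : measurableTypeR R => m [set x | (t < f x)%R]).
  by move=> mD; apply: measurable_tail => //; exact: f0.1.1.
rewrite -!ge0_integralZl ?lee_fin//=; try by [exact: mt|move=> *; exact: DTM_ge0].
rewrite -ge0_integralD//=.
- by move=> t _; rewrite mule_ge0 ?(DTM_ge0 _ muD) ?lee_fin//.
- by apply: measurable_funeM; exact: mt.
- by move=> t _; rewrite mule_ge0 ?(DTM_ge0 _ nuD) ?lee_fin//.
- by apply: measurable_funeM; exact: mt.
Qed.

(** The superlevel sets at nonnegative heights of two functions with product zero
    are disjoint. *)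
Lemma Pi_disjoint mu f g : DTM R X mu -> C0plus R X f -> C0plus R X g ->
  (forall x, f x * g x = 0)%R ->
  Pi mu (fun x => f x + g x)%R = Pi mu f + Pi mu g.
Proof.
move=> muD f0 g0 fg0.
have fg : C0plus R X (fun x => f x + g x)%R.
  by split; [apply: C0_add; [exact: f0.1|exact: g0.1]|move=> x; rewrite addr_ge0 ?f0.2 ?g0.2].
rewrite !Pi_tail// -ge0_integralD//=; try by move=> *; exact: DTM_ge0.
- apply: eq_integral => t; rewrite inE/= in_itv/= andbT => t0.
  rewrite -(DTM_openU hX muD).
  + congr (mu _); apply/seteqP; split => x /=.
      move=> tfg; have /eqP := fg0 x; rewrite mulf_eq0 => /orP[/eqP fx|/eqP gx].
        by right; move: tfg; rewrite fx add0r.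
      by left; move: tfg; rewrite gx addr0.
    by move=> [tf|tg]; [rewrite ltr_wpDr// g0.2|rewrite ltr_wpDl// f0.2].
  + by apply: open_superlevel; exact: f0.1.1.
  + by apply: open_superlevel; exact: g0.1.1.
  + rewrite -subset0 => x /= [/(le_lt_trans t0) fx /(le_lt_trans t0) gx].
    by have := fg0 x; apply/eqP; rewrite mulf_neq0 ?gt_eqF.
- by apply: measurable_tail => //; exact: f0.1.1.
- by apply: measurable_tail => //; exact: g0.1.1.
Qed.

Hypothesis lcX : locally_compact [set: X].

(** An Urysohn function of a compact [K] inside an open [U] separates [mu K] from
    [nu U]; the two regularity properties do the rest. *)
Lemma Pi_order mu nu : DTM R X mu -> DTM R X nu ->
  le_on open_or_closed mu nu <-> le_on (C0plus R X) (Pi mu) (Pi nu).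
Proof.
move=> muD nuD; split => [le f f0|le].
  by apply: Pi_le2 => // t t0; apply: le; apply: superlevel_oc; exact: f0.1.1.
have KU K U : compact K -> open U -> K `<=` U -> mu K <= nu U.
  move=> cK oU KU; have [f [f0 f1 fK fU]] := @urysohn_C0plus R X _ _ lcX hX cK oU KU.
  apply: (@le_trans _ _ (Pi mu f)).
    by apply: Pi_ge_supp => //; [exact: compact_oc|move=> x /fK ->].
  by apply: le_trans (le _ f0) _; exact: Pi_le_supp.
have UU U : open U -> mu U <= nu U.
  move=> oU; have [[_ _ iro _] _ _] := muD; rewrite (iro _ oU).
  by apply: ge_ereal_sup => _ [K [cK sKU] <-]; exact: KU.
move=> A [oA|cA]; first exact: UU.
have [[_ _ _ orc] _ _] := nuD; rewrite (orc _ cA).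
apply: le_ereal_inf_tmp => _ [U [oU AU] <-].
by apply: le_trans (UU _ oU); apply: (DTM_le muD) => //; [right|left].
Qed.

(** The supremum is approached on Urysohn functions of compact sets of nearly full
    measure. *)
Lemma Pi_norm mu : DTM R X mu -> functional_norm (C0plus R X) (Pi mu) = mu setT.
Proof.
move=> muD; apply/eqP; rewrite eq_le; apply/andP; split.
  apply: ge_ereal_sup => _ [f [f0 f1] <-]; rewrite gee0_abs ?Pi_ge0//.
  apply: Pi_le_supp => //; [exact: openT|..].
  - move=> x; rewrite -lee_fin; apply: le_trans f1; apply: ereal_sup_ubound.
    by exists x => //=; rewrite ger0_norm// f0.2.
  - by move=> x /(_ I).
have [[_ _ iro _] _ _] := muD; rewrite (iro _ openT).
apply: ge_ereal_sup => _ [K [cK _] <-].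
have [f [f0 f1 fK fU]] := @urysohn_C0plus R X _ _ lcX hX cK openT (fun _ _ => I).
apply: (@le_trans _ _ (Pi mu f)).
  by apply: Pi_ge_supp => //; [exact: compact_oc|move=> x /fK ->].
apply: ereal_sup_ubound; exists f; last by rewrite gee0_abs ?Pi_ge0.
split => //; apply: ge_ereal_sup => _ [x _ <-].
by rewrite lee_fin ger0_norm ?f1// f0.2.
Qed.

End Pi_bounds.

(** * Comonotone additivity *)

Section comonotone.
Local Open Scope ereal_scope.
Context {R : realType} {X : ptopologicalType}.
Hypotheses (hX : hausdorff_space X) (cX : connected [set: X]).
Implicit Types (mu nu : set X -> \bar R) (f g h : X -> R).
Local Notation leb := (@lebesgue_measure R).

(** [g] is a nondecreasing function of [f], expressed without choosing a function
    on the real line; this form is stable under conic combinations. *)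
Definition increasing_in f g := forall x y, (f x <= f y -> g x <= g y)%R.

(** A nondecreasing function on the whole real line whose composite with [f] is
    [g], when [g >= 0] is a nondecreasing function of [f].  Taking the supremum from
    the left makes the lift additive in [g], see [monotone_lift_lin].  The supremum of
    the empty set is 0, which is the right value below the range of [f]. *)
Definition monotone_lift f g (s : R) : R :=
  sup [set g x | x in [set x | (f x <= s)%R]].

Section lift.
Variables (f g : X -> R) (M : R).
Hypotheses (g0 : forall x, (0 <= g x)%R) (gM : forall x, (g x <= M)%R).
Let psi := monotone_lift f g.

Let bnd s : has_ubound [set g x | x in [set x | (f x <= s)%R]].
Proof. by exists M => _ [x _ <-]. Qed.

Lemma monotone_lift_ge s x : (f x <= s)%R -> (g x <= psi s)%R.
Proof. by move=> fx; apply: ub_le_sup => //; exists x. Qed.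

Lemma monotone_lift_ge0 s : (0 <= psi s)%R.
Proof.
have [E|/set0P [_ [x fx _]]] := eqVneq [set g x | x in [set x | (f x <= s)%R]] set0.
  by rewrite /psi/monotone_lift E sup0.
exact: le_trans (g0 x) (monotone_lift_ge fx).
Qed.

Lemma monotone_lift_nd : {homo psi : s t / (s <= t)%R}.
Proof.
move=> s t st.
have [E|/set0P ne] := eqVneq [set g x | x in [set x | (f x <= s)%R]] set0.
  by rewrite {1}/psi/monotone_lift E sup0 monotone_lift_ge0.
apply: ge_sup => // _ [x fx <-]; apply: monotone_lift_ge.
exact: le_trans st.
Qed.

Lemma monotone_lift_gt s t : (0 <= t)%R ->
  (t < psi s)%R <-> exists2 x, (f x <= s)%R & (t < g x)%R.
Proof.
move=> t0; split => [ts|[x fx tg]]; last exact: lt_le_trans (monotone_lift_ge fx).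
have [E|/set0P ne] := eqVneq [set g x | x in [set x | (f x <= s)%R]] set0.
  by move: ts; rewrite /psi/monotone_lift E sup0 ltNge t0.
have e0 : (0 < psi s - t)%R by rewrite subr_gt0.
have [_ [x fx <-]] := sup_adherent e0 (conj ne (bnd s)).
by rewrite /psi subKr => tg; exists x.
Qed.

Lemma measurable_monotone_lift : measurable_fun [set: measurableTypeR R] psi.
Proof. by apply: nondecreasing_measurable => //; exact: monotone_lift_nd. Qed.

End lift.

(** Points that nearly attain the two suprema can be replaced by the one with the
    larger value of [f], so a single point nearly attains both. *)
Lemma monotone_lift_lin f g h (a b M : R) :
  (forall x, 0 <= g x <= M)%R -> (forall x, 0 <= h x <= M)%R ->
  increasing_in f g -> increasing_in f h -> (0 <= a)%R -> (0 <= b)%R ->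
  forall s, monotone_lift f (fun x => a * g x + b * h x)%R s =
    (a * monotone_lift f g s + b * monotone_lift f h s)%R.
Proof.
move=> gM hM fg fh a0 b0 s.
have [E|/set0P [x0 fx0]] := eqVneq [set x | (f x <= s)%R] set0.
  by rewrite /monotone_lift E !image_set0 !sup0 !mulr0 addr0.
have g1 x : (g x <= M)%R by have /andP[] := gM x.
have h1 x : (h x <= M)%R by have /andP[] := hM x.
apply/eqP; rewrite eq_le; apply/andP; split.
  apply: ge_sup; first by exists (a * g x0 + b * h x0)%R, x0.
  by move=> _ [x fx <-]; rewrite lerD// ler_wpM2l//; exact: (monotone_lift_ge (M := M)).
apply/ler_addgt0Pr => e e0.
have c0 : (0 < a + b + 1)%R by rewrite ltr_wpDl// addr_ge0.
have d0 : (0 < e / (a + b + 1))%R by rewrite divr_gt0.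
have adh k : (forall x, (k x <= M)%R) ->
    exists2 x, (f x <= s)%R & (monotone_lift f k s - e / (a + b + 1) < k x)%R.
  move=> kM; have ne : has_sup [set k x | x in [set x | (f x <= s)%R]].
    by split; [exists (k x0), x0|exists M => _ [x _ <-]].
  by have [_ [x fx <-] xk] := sup_adherent d0 ne; exists x.
have [x fx gx] := adh _ g1; have [y fy hy] := adh _ h1.
(* The point with the larger value of [f] serves for both functions. *)
have [z [fz gz hz]] : exists z, [/\ (f z <= s)%R, (g x <= g z)%R & (h y <= h z)%R].
  have [xy|/ltW yx] := leP (f x) (f y).
    by exists y; split => //; exact: fg.
  by exists x; split => //; exact: fh.
apply: (@le_trans _ _ (a * g z + b * h z + e)%R); last first.
  rewrite lerD2r; apply: ub_le_sup; last by exists z.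
  exists (a * M + b * M)%R => _ [w _ <-].
  by rewrite lerD// ler_wpM2l.
have h3 := ler_wpM2l a0 (ltW (lt_le_trans gx gz)).
have h4 := ler_wpM2l b0 (ltW (lt_le_trans hy hz)).
have h5 : ((a + b) * (e / (a + b + 1)) <= e)%R.
  by rewrite mulrA ler_pdivrMr// mulrC ler_pM2l// lerDl.
move: h3 h4 h5; rewrite !mulrBr mulrDl.
by lra.
Qed.

(** The superlevel set of the lift is the upward closure of the image under [f] of
    the superlevel set [G] of [g].  If [f] has no minimum on [G], it is an open ray and
    [G] is a superlevel set of [f].  If [f] has a minimum [c] on [G], then [G] is
    both open and the closed set [c <= f], hence the whole connected space. *)
Lemma ls_monotone_lift mu f g (t : R) : DTM R X mu -> C0 R X f -> C0plus R X g ->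
  increasing_in f g -> (0 <= t)%R ->
  ls_measure (fun t => - R1 mu f t)%R [set s | (t < monotone_lift f g s)%R] =
  mu [set x | (t < g x)%R].
Proof.
move=> muD f0 gp fg t0; have cf := f0.1; have [M M0 fM] := C0_bounded f0.
have [N N0 gN] := C0_bounded gp.1.
have gN' x : (g x <= N)%R by exact: le_trans (ler_norm _) (gN x).
pose G := [set x | (t < g x)%R].
have SE : [set s | (t < monotone_lift f g s)%R] =
    [set s | exists2 x, (f x <= s)%R & G x].
  by apply/seteqP; split => s; move/(monotone_lift_gt f gN' s t0).
rewrite SE.
have [GE|/set0P G0] := eqVneq G set0.
  rewrite -/G GE (DTM_set0 muD) (_ : [set s | _] = set0) ?measure0//.
  by rewrite -subset0 => s [x _].
have [[x Gx xmin]|nmin] := pselect (exists2 x, G x & forall y, G y -> (f x <= f y)%R).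
  (* The minimum of [f] is attained on [G], which is then open and closed. *)
  have GT : G = setT.
    apply: cX => //.
      by exists G; [apply: open_superlevel; exact: gp.1.1|rewrite setTI].
    exists G; last by rewrite setTI.
    have -> : G = [set y | (f x <= f y)%R].
      apply/seteqP; split => y; first exact: xmin.
      by move=> /fg; exact: lt_le_trans.
    exact: closed_superlevel.
  have -> : [set s | exists2 x, (f x <= s)%R & G x] = setT `\` `]-oo, f x[.
    apply/seteqP; split => s /=; rewrite in_itv/=.
      by move=> [y ys Gy]; split => //; apply/negP; rewrite -leNgt (le_trans (xmin _ Gy)).
    by move=> [_ /negP]; rewrite -leNgt => fxs; exists x.
  rewrite -/G GT -(ls_setT muD cf fM) measureD//=.
  - have cmin y : (f x <= f y)%R by apply: xmin; rewrite GT.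
    by rewrite setTI (ls_lt0 muD cf fM cmin) sube0.
  - by rewrite (ls_setT muD cf fM); case: muD.
have hinf : has_inf (f @` G).
  split; first by case: G0 => x Gx; exists (f x), x.
  by exists (- M)%R => _ [x _ <-]; rewrite lerNl (le_trans _ (fM x))// -normrN ler_norm.
pose c := inf (f @` G).
have cG y : G y -> (c < f y)%R.
  move=> Gy; have cy z : G z -> (c <= f z)%R.
    by move=> Gz; apply: ge_inf; [exact: hinf.2|exists z].
  rewrite lt_neqAle cy// andbT; apply/eqP => E; apply: nmin; exists y => // z.
  by rewrite -E; exact: cy.
have Gc s : (c < s)%R -> exists2 x, (f x < s)%R & G x.
  move=> cs; have e0 : (0 < s - c)%R by rewrite subr_gt0.
  by have [_ [x Gx <-]] := inf_adherent e0 hinf; rewrite addrC subrK => fx; exists x.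
have -> : [set s | exists2 x, (f x <= s)%R & G x] = `]c, +oo[%classic.
  apply/seteqP; split => s /=; rewrite in_itv/= andbT.
    by move=> [x fx /cG]; move/lt_le_trans; apply.
  by move=> /Gc [x /ltW]; exists x.
rewrite (ls_rayE muD cf fM); congr (mu _); apply/seteqP; split => y /=; last exact: cG.
by move=> /Gc [x /ltW /fg]; move=> gxy Gx; exact: lt_le_trans gxy.
Qed.

Lemma Pi_monotone_lift mu f g : DTM R X mu -> C0 R X f -> C0plus R X g ->
  increasing_in f g ->
  Pi mu g = \int[ls_measure (fun t => - R1 mu f t)%R]_s (monotone_lift f g s)%:E.
Proof.
move=> muD f0 gp fg; have [M M0 fM] := C0_bounded f0.
have [N N0 gN] := C0_bounded gp.1.
have gN' x : (g x <= N)%R by exact: le_trans (ler_norm _) (gN x).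
apply: Pi_layer => //.
- by rewrite (ls_setT muD f0.1 fM); case: muD.
- by apply: measurable_monotone_lift; [exact: gp.2|exact: gN'].
- by move=> s; apply: monotone_lift_ge0; [exact: gp.2|exact: gN'].
- by move=> t t0; exact: ls_monotone_lift.
Qed.

(** Both functions are transported to the real line with the Stieltjes measure of
    [f], where the integral is linear. *)
Lemma Pi_comonotone mu f g h (a b : R) : DTM R X mu -> C0 R X f ->
  C0plus R X g -> C0plus R X h -> increasing_in f g -> increasing_in f h ->
  (0 <= a)%R -> (0 <= b)%R ->
  Pi mu (fun x => a * g x + b * h x)%R = a%:E * Pi mu g + b%:E * Pi mu h.
Proof.
move=> muD f0 gp hp fg fh a0 b0.
have [N N0 gN] := C0_bounded gp.1; have [P P0 hP] := C0_bounded hp.1.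
have gb x : (0 <= g x <= N + P)%R.
  by rewrite gp.2/= (le_trans (ler_norm _))// (le_trans (gN x))// lerDl ltW.
have hb x : (0 <= h x <= N + P)%R.
  by rewrite hp.2/= (le_trans (ler_norm _))// (le_trans (hP x))// lerDr ltW.
have g1 x : (g x <= N + P)%R by have /andP[] := gb x.
have h1 x : (h x <= N + P)%R by have /andP[] := hb x.
rewrite (@Pi_monotone_lift _ f)//; [|exact: C0plus_lin|]; last first.
  by move=> x y xy; rewrite lerD// ler_wpM2l//; [exact: fg|exact: fh].
rewrite (@Pi_monotone_lift _ f g)// (@Pi_monotone_lift _ f h)//.
under eq_integral do rewrite (monotone_lift_lin gb hb)// EFinD !EFinM.
have mg : measurable_fun [set: measurableTypeR R] (monotone_lift f g).
  by apply: measurable_monotone_lift; [exact: gp.2|exact: g1].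
have mh : measurable_fun [set: measurableTypeR R] (monotone_lift f h).
  by apply: measurable_monotone_lift; [exact: hp.2|exact: h1].
have pg s : (0 <= monotone_lift f g s)%R.
  by apply: monotone_lift_ge0; [exact: gp.2|exact: g1].
have ph s : (0 <= monotone_lift f h s)%R.
  by apply: monotone_lift_ge0; [exact: hp.2|exact: h1].
rewrite ge0_integralD//=.
- rewrite !ge0_integralZl//; try by [exact/measurable_EFinP|move=> s _; rewrite lee_fin].
- by move=> s _; rewrite mule_ge0 ?lee_fin.
- by apply: measurable_funeM; exact/measurable_EFinP.
- by move=> s _; rewrite mule_ge0 ?lee_fin.
- by apply: measurable_funeM; exact/measurable_EFinP.
Qed.

Lemma Aplus_increasing f g : Aplus f g -> increasing_in f g.
Proof.
move=> [phi [_ nd _ ->]] x y xy /=.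
by apply: nd => //; apply: mem_set; apply: subset_closure; [exists x|exists y].
Qed.

End comonotone.

(** * p-conic quasi-linear functionals *)

Section Pi_is_conic.
Local Open Scope ereal_scope.
Context {R : realType} {X : ptopologicalType}.
Hypotheses (hX : hausdorff_space X) (cX : connected [set: X])
  (lcX : locally_compact [set: X]).
Implicit Types (mu nu : set X -> \bar R) (f g h : X -> R).

Lemma Pi_scale mu f (a : R) : DTM R X mu -> C0plus R X f -> (0 <= a)%R ->
  Pi mu (fun x => a * f x)%R = a%:E * Pi mu f.
Proof.
move=> muD f0 a0; have ff : increasing_in f f by [].
have := Pi_comonotone cX muD f0.1 f0 f0 ff ff a0 (lexx 0%R).
by rewrite mul0e adde0; under eq_fun do rewrite mul0r addr0.
Qed.

Lemma C0plus_scale f (a : R) : C0plus R X f -> (0 <= a)%R ->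
  C0plus R X (fun x => a * f x)%R.
Proof.
move=> [f0 fp] a0; split; first exact: C0_scale.
by move=> x; rewrite mulr_ge0.
Qed.

(** Rescaling to functions bounded by 1 bounds the functional by the total mass. *)
Lemma Pi_fin mu f : DTM R X mu -> Pi mu f \is a fin_num.
Proof.
move=> muD; have [f0|nf] := pselect (C0plus R X f); last by rewrite Pi_out.
rewrite ge0_fin_numE ?Pi_ge0//; have [M M0 fM] := C0_bounded f0.1.
have fE : f = (fun x => M * (M^-1 * f x))%R.
  by apply/funext => x; rewrite mulrA divff ?gt_eqF// mul1r.
have Mf : C0plus R X (fun x => M^-1 * f x)%R by apply: C0plus_scale; rewrite ?invr_ge0 ?ltW.
rewrite fE Pi_scale//; last exact: ltW.
apply: (@le_lt_trans _ _ (M%:E * mu setT)); last first.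
  by rewrite lte_mul_pinfty ?lee_fin ?ltW//; case: muD.
rewrite lee_pmul2l//; apply: Pi_le_supp => //; first exact: openT.
  by move=> x; rewrite mulrC ler_pdivrMr// mul1r (le_trans (ler_norm _))// fM.
by move=> x /(_ I).
Qed.

Lemma C0plus0 : C0plus R X (cst 0%R).
Proof. by split; [exact: C0_cst0|]. Qed.

Lemma Pi_Phiplus mu : DTM R X mu -> Phiplus R X (Pi mu).
Proof.
move=> muD; split.
- split.
  + split; last by rewrite -ge0_fin_numE ?abse_ge0// abse_fin_num Pi_fin.
    split.
    * by move=> [[f _ fy]]; have := Pi_fin f muD; rewrite fy.
    * by exists (cst 0%R); [exact: C0plus0|case/fin_numPlt/andP: (Pi_fin (cst 0%R) muD) => _ /lt_eqF ->].
    * by exists (cst 0%R); [exact: C0plus0|rewrite gt_eqF// (lt_le_trans _ (Pi_ge0 _ muD))].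
  + by move=> f g f0 g0; exact: Pi_disjoint.
  + by move=> f g f0 g0 gf; exact: Pi_mono.
  + move=> f f0 g h [/Aplus_increasing fg g0] [/Aplus_increasing fh h0] a b a0 b0.
    exact: (Pi_comonotone cX muD f0).
- by rewrite Pi_norm//; case: muD.
- by move=> f nf; rewrite Pi_out.
Qed.

End Pi_is_conic.

Section conic_functionals.
Local Open Scope ereal_scope.
Context {R : realType} {X : ptopologicalType}.
Implicit Types (rho : (X -> R) -> \bar R) (f g h : X -> R).

Lemma Aplus_comp f (phi : R -> R) : continuous phi -> {homo phi : s t / (s <= t)%R} ->
  phi 0%R = 0%R -> Aplus f (phi \o f).
Proof.
move=> cphi nd phi0; exists phi; split => //.
  exact: continuous_subspaceT.
by move=> s t _ _; exact: nd.
Qed.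

Lemma conic_scale rho f (a : R) : p_conic_quasi_linear rho -> C0plus R X f ->
  (0 <= a)%R -> rho (fun x => a * f x)%R = a%:E * rho f.
Proof.
move=> [_ _ _ p3] f0 a0; have Af : (Aplus f `&` C0plus R X) f.
  split => //; rewrite -[X in Aplus _ X]/(id \o f); apply: Aplus_comp => //.
  by move=> x; exact: cvg_id.
have := p3 _ f0.1 _ _ Af Af _ _ a0 (lexx 0%R).
by rewrite mul0e adde0; under eq_fun do rewrite mul0r addr0.
Qed.

Lemma conic0 rho : p_conic_quasi_linear rho -> rho (cst 0%R) = 0.
Proof.
move=> rhoP; have := conic_scale rhoP (C0plus0 (X := X)) (lexx 0%R).
rewrite mul0e => <-; congr rho; apply/funext => x /=; by rewrite mul0r.
Qed.

Lemma conic_ge0 rho f : p_conic_quasi_linear rho -> C0plus R X f -> 0 <= rho f.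
Proof.
move=> rhoP f0; rewrite -(conic0 rhoP); have [_ _ p2 _] := rhoP.
by apply: p2 => //; [exact: C0plus0|exact: f0.2].
Qed.

(** Homogeneity turns the norm into a bound on every bounded function. *)
Lemma conic_le_norm rho f (c : R) : p_conic_quasi_linear rho -> C0plus R X f ->
  (0 < c)%R -> (forall x, f x <= c)%R ->
  rho f <= c%:E * functional_norm (C0plus R X) rho.
Proof.
move=> rhoP f0 c0 fc.
have fE : f = (fun x => c * (c^-1 * f x))%R.
  by apply/funext => x; rewrite mulrA divff ?gt_eqF// mul1r.
have cf : C0plus R X (fun x => c^-1 * f x)%R by apply: C0plus_scale; rewrite ?invr_ge0 ?ltW.
rewrite [X in rho X]fE conic_scale//; last exact: ltW.
rewrite lee_pmul2l//; apply: ereal_sup_ubound.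
exists (fun x => c^-1 * f x)%R; last by rewrite gee0_abs ?conic_ge0.
split => //; apply: ge_ereal_sup => _ [x _ <-].
by rewrite lee_fin ger0_norm ?cf.2// mulrC ler_pdivrMr// mul1r.
Qed.

Lemma continuous_minr (a : R) (phi : R -> R) : continuous phi ->
  continuous (fun s => Num.min (phi s) a).
Proof.
move=> cphi s; apply: (@continuous_min R R phi (cst a) s); first exact: cphi.
exact: cst_continuous.
Qed.

Lemma continuous_maxr (a : R) (phi : R -> R) : continuous phi ->
  continuous (fun s => Num.max (phi s) a).
Proof.
move=> cphi s; apply: (@continuous_max R R phi (cst a) s); first exact: cphi.
exact: cst_continuous.
Qed.

Definition trunc (c s : R) : R := Num.min s c.
Definition excess (c s : R) : R := Num.max (s - c)%R 0%R.

Lemma continuous_trunc c : continuous (trunc c).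
Proof. by apply: continuous_minr => s; exact: cvg_id. Qed.

Lemma continuous_excess c : continuous (excess c).
Proof.
apply: continuous_maxr => s; apply: cvgB; [exact: cvg_id|exact: cvg_cst].
Qed.

Lemma trunc_nd c : {homo trunc c : s t / (s <= t)%R}.
Proof. by move=> s t st; rewrite /trunc le_min !ge_min st lexx orbT. Qed.

Lemma excess_nd c : {homo excess c : s t / (s <= t)%R}.
Proof. by move=> s t st; rewrite /excess ge_max !le_max lerB// lexx orbT. Qed.

Lemma Aplus_trunc f c : (0 <= c)%R -> C0plus R X f ->
  (Aplus f `&` C0plus R X) (trunc c \o f).
Proof.
move=> c0 f0; split.
  by apply: Aplus_comp; [exact: continuous_trunc|exact: trunc_nd|rewrite /trunc min_l].
apply: (C0plus_dom (c := 1) f0).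
  by move=> x; apply: continuous_comp; [exact: f0.1.1|exact: continuous_trunc].
by move=> x; rewrite /= /trunc mul1r le_min f0.2 c0/= ge_min lexx.
Qed.

Lemma Aplus_excess f c : (0 <= c)%R -> C0plus R X f ->
  (Aplus f `&` C0plus R X) (excess c \o f).
Proof.
move=> c0 f0; split.
  apply: Aplus_comp; [exact: continuous_excess|exact: excess_nd|].
  by rewrite /excess sub0r max_r// oppr_le0.
apply: (C0plus_dom (c := 1) f0).
  by move=> x; apply: continuous_comp; [exact: f0.1.1|exact: continuous_excess].
by move=> x; rewrite /= /excess mul1r le_max lexx orbT/= ge_max f0.2 gerBl c0.
Qed.

Lemma Aplus_slice f c e : (0 <= c)%R -> (0 <= e)%R -> C0plus R X f ->
  (Aplus f `&` C0plus R X) (trunc e \o excess c \o f).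
Proof.
move=> c0 e0 f0; split.
  apply: Aplus_comp.
  - move=> s; apply: continuous_comp; [exact: continuous_excess|exact: continuous_trunc].
  - by move=> s t st; apply: trunc_nd; exact: excess_nd.
  - by rewrite /= /excess sub0r max_r ?oppr_le0// /trunc min_l.
exact: (Aplus_trunc e0 (Aplus_excess c0 f0).2).2.
Qed.

(** The layer of [s] between the heights [c] and [c + e] is [trunc e (excess c s)]. *)
Lemma trunc_excess c e s : (0 <= e)%R -> (0 <= c)%R ->
  trunc (c + e) s = (1 * trunc c s + 1 * trunc e (excess c s))%R.
Proof.
move=> e0 c0; rewrite !mul1r /trunc /excess.
have [sc|cs] := leP s c.
  rewrite (min_l (_ : s <= c + e)%R) ?ler_wpDr//.
  by rewrite max_r ?subr_le0// min_l// addr0.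
rewrite max_l ?subr_ge0 1?ltW//.
have [sce|sce] := leP s (c + e)%R.
  by rewrite min_l ?lerBlDl// addrC subrK.
by rewrite min_r// lerBrDl ltW.
Qed.

Lemma conic_trunc_add rho f c e : p_conic_quasi_linear rho -> C0plus R X f ->
  (0 <= c)%R -> (0 <= e)%R ->
  rho (trunc (c + e) \o f) = rho (trunc c \o f) + rho (trunc e \o excess c \o f).
Proof.
move=> [_ _ _ p3] f0 c0 e0.
have := p3 _ f0.1 _ _ (Aplus_trunc c0 f0) (Aplus_slice c0 e0 f0) 1%R 1%R ler01 ler01.
rewrite !mul1e => <-; congr rho; apply/funext => x /=.
exact: trunc_excess.
Qed.

Lemma conic_trunc_excess rho f e : p_conic_quasi_linear rho -> C0plus R X f ->
  (0 <= e)%R -> rho f = rho (trunc e \o f) + rho (excess e \o f).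
Proof.
move=> [_ _ _ p3] f0 e0.
have := p3 _ f0.1 _ _ (Aplus_trunc e0 f0) (Aplus_excess e0 f0) 1%R 1%R ler01 ler01.
rewrite !mul1e => <-; congr rho; apply/funext => x /=.
rewrite !mul1r /trunc /excess; have [fe|ef] := leP (f x) e.
  by rewrite max_r ?addr0// subr_le0.
by rewrite max_l ?subr_ge0 1?ltW// addrC subrK.
Qed.

(** A function is the sum of its horizontal slices, all of them nondecreasing
    functions of it, so a p-conic quasi-linear functional is additive on them. *)
Lemma conic_slices rho f e n : p_conic_quasi_linear rho -> C0plus R X f ->
  (0 <= e)%R -> rho (trunc (n%:R * e) \o f) =
  \sum_(k < n) rho (trunc e \o excess (k%:R * e) \o f).
Proof.
move=> rhoP f0 e0; elim: n => [|n IH].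
  rewrite big_ord0 mul0r -(conic0 rhoP); congr rho; apply/funext => x /=.
  by rewrite /trunc min_r// f0.2.
rewrite big_ord_recr/= -IH -conic_trunc_add// ?mulr_ge0//.
by rewrite -natr1 mulrDl mul1r.
Qed.

Definition dominates (m : set X -> R) rho := forall U g, open U -> C0plus R X g ->
  (forall x, g x <= 1)%R -> (forall x, ~ U x -> g x = 0)%R -> rho g <= (m U)%:E.
Definition dominated (m : set X -> R) rho := forall U g, open U -> C0plus R X g ->
  (forall x, U x -> 1 <= g x)%R -> (m U)%:E <= rho g.

Lemma slice_le m rho f c e : p_conic_quasi_linear rho -> dominates m rho ->
  C0plus R X f -> (0 <= c)%R -> (0 < e)%R ->
  rho (trunc e \o excess c \o f) <= (e * m [set x | (c < f x)%R])%:E.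
Proof.
move=> rhoP dm f0 c0 e0; set g := _ \o f.
have g0 : C0plus R X g := (Aplus_slice c0 (ltW e0) f0).2.
have -> : g = (fun x => e * (e^-1 * g x))%R.
  by apply/funext => x; rewrite mulrA divff ?gt_eqF// mul1r.
have eg : C0plus R X (fun x => e^-1 * g x)%R.
  by apply: C0plus_scale => //; rewrite invr_ge0 ltW.
rewrite conic_scale//; last exact: ltW.
rewrite EFinM lee_pmul2l//; apply: dm => //.
- by apply: open_superlevel; exact: f0.1.1.
- by move=> x; rewrite mulrC ler_pdivrMr// mul1r /g/= /trunc ge_min lexx orbT.
- move=> x /= /negP; rewrite -leNgt => fc.
  by rewrite /g/= /excess max_r ?subr_le0// /trunc min_l ?mulr0// ltW.
Qed.

Lemma slice_ge m rho f c e : p_conic_quasi_linear rho -> dominated m rho ->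
  C0plus R X f -> (0 <= c)%R -> (0 < e)%R ->
  (e * m [set x | (c + e < f x)%R])%:E <= rho (trunc e \o excess c \o f).
Proof.
move=> rhoP dm f0 c0 e0; set g := _ \o f.
have g0 : C0plus R X g := (Aplus_slice c0 (ltW e0) f0).2.
have -> : g = (fun x => e * (e^-1 * g x))%R.
  by apply/funext => x; rewrite mulrA divff ?gt_eqF// mul1r.
have eg : C0plus R X (fun x => e^-1 * g x)%R.
  by apply: C0plus_scale => //; rewrite invr_ge0 ltW.
rewrite conic_scale//; last exact: ltW.
rewrite EFinM lee_pmul2l//; apply: dm => //.
- by apply: open_superlevel; exact: f0.1.1.
- move=> x /= cef; rewrite mulrC ler_pdivlMr// mul1r /g/= /excess max_l; last first.
    by rewrite subr_ge0 ltW// (le_lt_trans _ cef)// lerDl ltW.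
  by rewrite /trunc min_r// lerBrDl ltW.
Qed.

(** With slices of height [e], the upper sum for [rho1] and the lower sum for [rho2]
    differ by [e] times a telescoping sum, which is at most [e * m (f > 0)]. *)
Lemma conic_squeeze m rho1 rho2 f : p_conic_quasi_linear rho1 ->
  p_conic_quasi_linear rho2 -> dominates m rho1 -> dominated m rho2 ->
  (forall U, 0 <= m U)%R -> C0plus R X f -> rho1 f <= rho2 f.
Proof.
move=> p1 p2 d1 d2 m0 f0; apply/lee_addgt0Pr => d d0.
pose q := m [set x | (0 < f x)%R].
(* Adding 1 avoids a case distinction on [q = 0]. *)
pose e := (d / (q + 1))%R.
have q1 : (0 < q + 1)%R by rewrite ltr_wpDl ?m0.
have e0 : (0 < e)%R by rewrite divr_gt0.
have [M M0 fM] := C0_bounded f0.1.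
have [n /ltW Mn] := ex_nat_gt (M / e).
have fE : trunc (n%:R * e) \o f = f.
  apply/funext => x /=; rewrite /trunc min_l// (le_trans (ler_norm _))//.
  by rewrite (le_trans (fM x))// -ler_pdivrMr.
rewrite -fE !conic_slices ?(ltW e0)//.
have ke k : (0 <= k%:R * e)%R by rewrite mulr_ge0// ltW.
pose u k := m [set x | (k%:R * e < f x)%R].
apply: (@le_trans _ _ (\sum_(k < n) (e * u k)%:E)).
  by apply: lee_sum => k _; apply: slice_le.
apply: (@le_trans _ _ (\sum_(k < n) (e * u k.+1)%:E + d%:E)); last first.
  rewrite leeD2r//; apply: lee_sum => k _.
  have := slice_ge p2 d2 f0 (ke k) e0.
  by rewrite (_ : k%:R * e + e = k.+1%:R * e)%R// -natr1 mulrDl mul1r.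
rewrite !sumEFin -EFinD lee_fin.
rewrite addrC -lerBlDr -sumrB.
have -> : (\sum_(i < n) (e * u i - e * u i.+1))%R = (e * u 0%N - e * u n)%R.
  elim: n {Mn fE} => [|n IH]; first by rewrite big_ord0 subrr.
  by rewrite big_ord_recr/= IH addrA subrK.
rewrite lerBlDr ler_wpDr//; first by rewrite mulr_ge0 ?(ltW e0)// m0.
rewrite /u mul0r -/q.
by rewrite /e mulrAC ler_pdivrMr// ler_pM2l// lerDl.
Qed.

End conic_functionals.

(** * The deficient topological measure of a functional *)

Section compact_separation.
Context {R : realType} {X : ptopologicalType}.

Lemma compact_separation (C K : set X) : locally_compact [set: X] ->
  hausdorff_space X -> compact C -> compact K -> C `&` K = set0 ->
  exists U V : set X, [/\ open U, open V, C `<=` U, K `<=` V & U `&` V = set0].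
Proof.
move=> lcX hX cC cK CK0.
have oK : open (~` K) by apply: closed_openC; exact: compact_closed.
have CnK : C `<=` ~` K by move=> x Cx Kx; have : set0 x by rewrite -CK0.
have [f [f0 f1 fC fK]] := @urysohn_C0plus R X _ _ lcX hX cC oK CnK.
exists [set x | 2^-1 < f x], [set x | f x < 2^-1]; split.
- by apply: open_superlevel; exact: f0.1.1.
- by apply: open_sublevel; exact: f0.1.1.
- by move=> x /fC /= ->; rewrite invf_lt1// ltr1n.
- by move=> x Kx; rewrite /= fK//; apply/not_notP.
- by rewrite -subset0 => x /= [/lt_trans h /h]; rewrite ltxx.
Qed.

End compact_separation.

Section surjectivity.
Local Open Scope ereal_scope.
Context {R : realType} {X : ptopologicalType}.
Hypotheses (hX : hausdorff_space X) (cX : connected [set: X])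
  (lcX : locally_compact [set: X]).
Implicit Types (f g h : X -> R) (U V W : set X).
Variable rho : (X -> R) -> \bar R.
Hypothesis rhoP : Phiplus R X rho.

Let cq : p_conic_quasi_linear rho. Proof. by case: rhoP. Qed.

(** Test functions need only vanish off [U], rather than have compact support inside
    [U]; the excess over a small height provides the compact support when it matters. *)
Definition subordinate U : set (X -> R) :=
  [set g | [/\ C0plus R X g, forall x, (g x <= 1)%R & forall x, ~ U x -> g x = 0%R]].

Definition open_mass U : \bar R := ereal_sup [set rho g | g in subordinate U].

Definition induced_mass (A : set X) : \bar R :=
  if pselect (open_or_closed A) then
    ereal_inf [set open_mass U | U in [set U | open U /\ A `<=` U]]
  else 0.

Let N := fine (functional_norm (C0plus R X) rho).

Lemma subordinate0 U : subordinate U (cst 0%R).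
Proof. by split => //; exact: C0plus0. Qed.

Let norm_ge0 : 0 <= functional_norm (C0plus R X) rho.
Proof.
apply: ereal_sup_ubound; exists (cst 0%R); last by rewrite (conic0 cq) abse0.
split; first exact: C0plus0.
by apply: ge_ereal_sup => _ [x _ <-]; rewrite normr0 lee_fin.
Qed.

Let normE : functional_norm (C0plus R X) rho = N%:E.
Proof. by rewrite /N fineK// ge0_fin_numE//; case: rhoP. Qed.

Let N0 : (0 <= N)%R. Proof. by rewrite -lee_fin -normE. Qed.

Lemma rho_le g (c : R) : C0plus R X g -> (0 < c)%R -> (forall x, g x <= c)%R ->
  rho g <= (c * N)%:E.
Proof. by move=> g0 c0 gc; rewrite EFinM -normE; exact: conic_le_norm. Qed.

Lemma open_mass_ge0 U : 0 <= open_mass U.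
Proof.
by apply: ereal_sup_ubound; exists (cst 0%R); [exact: subordinate0|exact: conic0].
Qed.

Lemma open_mass_le_norm U : open_mass U <= N%:E.
Proof.
by apply: ge_ereal_sup => _ [g [g0 g1 _] <-]; rewrite -[N]mul1r; exact: rho_le.
Qed.

Lemma open_mass_fin U : open_mass U \is a fin_num.
Proof.
by rewrite ge0_fin_numE ?open_mass_ge0// (le_lt_trans (open_mass_le_norm U))// ltry.
Qed.

Lemma le_open_mass U V : U `<=` V -> open_mass U <= open_mass V.
Proof.
move=> UV; apply: ereal_sup_le => _ [g [g0 g1 gU] <-]; exists g => //; split => //.
by move=> x nV; apply: gU => /UV.
Qed.

Lemma induced_mass_inf A : open_or_closed A -> induced_mass A =
  ereal_inf [set open_mass U | U in [set U | open U /\ A `<=` U]].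
Proof. by rewrite /induced_mass; case: pselect. Qed.

Lemma induced_mass_open U : open U -> induced_mass U = open_mass U.
Proof.
move=> oU; rewrite induced_mass_inf; last by left.
apply/eqP; rewrite eq_le; apply/andP; split.
  by apply: ereal_inf_lbound; exists U => //; split.
by apply: le_ereal_inf_tmp => _ [V [oV UV] <-]; exact: le_open_mass.
Qed.

Lemma induced_mass_le A U : open_or_closed A -> open U -> A `<=` U ->
  induced_mass A <= open_mass U.
Proof.
by move=> oA oU AU; rewrite induced_mass_inf//; apply: ereal_inf_lbound; exists U.
Qed.

Lemma induced_mass_ge0 A : 0 <= induced_mass A.
Proof.
rewrite /induced_mass; case: pselect => //= _.
by apply: le_ereal_inf_tmp => _ [V _ <-]; exact: open_mass_ge0.
Qed.

Lemma open_mass_adherent U (e : R) : (0 < e)%R ->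
  exists2 g, subordinate U g & open_mass U <= rho g + e%:E.
Proof.
move=> e0; have [_ [g gU <-] ge] := ub_ereal_sup_adherent e0 (open_mass_fin U).
by exists g => //; rewrite -leeBlDr//; exact: ltW.
Qed.

(** A test function for the union is cut along the two open sets, and test functions
    for the two sets have product zero, so the functional is additive in both cases. *)
Lemma open_massU U V : open U -> open V -> U `&` V = set0 ->
  open_mass (U `|` V) = open_mass U + open_mass V.
Proof.
move=> oU oV UV0; have [_ p1 _ _] := cq.
apply/eqP; rewrite eq_le; apply/andP; split.
  apply: ge_ereal_sup => _ [g [g0 g1 gUV] <-].
  have gUV' x : ~ U x -> ~ V x -> g x = 0%R by move=> nU nV; apply: gUV => -[].
  have sub W W' : open W -> open W' -> W `&` W' = set0 ->
      (forall x, ~ W x -> ~ W' x -> g x = 0%R) -> subordinate W (cut W g).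
    move=> oW oW' WW0 gW; split.
    - split; first by apply: (cut_C0 oW oW' WW0) => //; exact: g0.1.
      by move=> x; rewrite /cut; case: ifPn => // _; exact: g0.2.
    - by move=> x; rewrite /cut; case: ifPn.
    - by move=> x Wx; rewrite /cut memNset.
  have sU := sub U V oU oV UV0 gUV'.
  have sV : subordinate V (cut V g).
    by apply: (sub V U) => //; [rewrite setIC|move=> x nV nU; exact: gUV'].
  have -> : g = (fun x => cut U g x + cut V g x)%R.
    apply/funext => x; rewrite /cut; have [Ux|nU] := pselect (U x).
      rewrite mem_set// memNset ?addr0// => Vx.
      by have : set0 x by rewrite -UV0.
    rewrite memNset// add0r; case: ifPn => // nV.
    by apply: gUV' => //; move: nV; rewrite notin_setE.
  rewrite p1; first by apply: leeD; apply: ereal_sup_ubound; [exists (cut U g)|exists (cut V g)].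
  - by case: sU.
  - by case: sV.
  - move=> x; rewrite /cut; case: ifPn => [Ux|]; last by rewrite mul0r.
    rewrite memNset ?mulr0// => Vx.
    by have : set0 x by rewrite -UV0; split => //; exact: set_mem.
apply/lee_addgt0Pr => e e0; have e20 : (0 < e / 2)%R by rewrite divr_gt0.
have [g [g0 g1 gU] gle] := open_mass_adherent U e20.
have [h [h0 h1 hV] hle] := open_mass_adherent V e20.
apply: le_trans (leeD gle hle) _.
rewrite addeACA -EFinD -splitr leeD2r//.
have gh0 x : (g x * h x = 0)%R.
  have [Ux|/gU ->] := pselect (U x); last by rewrite mul0r.
  rewrite hV ?mulr0// => Vx.
  by have : set0 x by rewrite -UV0.
rewrite -p1//; apply: ereal_sup_ubound; exists (fun x => g x + h x)%R => //; split.
- by split; [apply: C0_add; [exact: g0.1|exact: h0.1]|move=> x; rewrite addr_ge0 ?g0.2 ?h0.2].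
- move=> x; have /eqP := gh0 x; rewrite mulf_eq0 => /orP[/eqP ->|/eqP ->].
    by rewrite add0r.
  by rewrite addr0.
- by move=> x /not_orP[nU nV]; rewrite gU// hV// addr0.
Qed.

(** The excess of a test function [g] over a small [e] is supported in the compact
    set [e <= g], and the part cut off has height at most [e]. *)
Lemma induced_mass_inner U : open U -> induced_mass U =
  ereal_sup [set induced_mass C | C in [set C | compact C /\ C `<=` U]].
Proof.
move=> oU; rewrite induced_mass_open//.
apply/eqP; rewrite eq_le; apply/andP; split; last first.
  apply: ge_ereal_sup => _ [K [cK KU] <-]; apply: induced_mass_le => //.
  exact: compact_oc.
apply: ge_ereal_sup => _ [g [g0 g1 gU] <-]; apply/lee_addgt0Pr => d d0.
pose e := (d / (N + 1))%R.
have N1 : (0 < N + 1)%R by rewrite ltr_wpDl.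
have e0 : (0 < e)%R by rewrite divr_gt0.
have cK : compact [set x | (e <= g x)%R] by exact: compact_superlevel.
have KU : [set x | (e <= g x)%R] `<=` U.
  by move=> x /= egx; apply: contrapT => /gU gx; move: egx; rewrite gx leNgt e0.
rewrite (conic_trunc_excess cq g0 (ltW e0)) addeC; apply: leeD.
  apply: (@le_trans _ _ (induced_mass [set x | (e <= g x)%R])); last first.
    by apply: ereal_sup_ubound; exists [set x | (e <= g x)%R].
  rewrite induced_mass_inf; last exact: compact_oc.
  apply: le_ereal_inf_tmp => _ [V [oV KV] <-]; apply: ereal_sup_ubound.
  exists (excess e \o g) => //; split.
  - exact: (Aplus_excess (ltW e0) g0).2.
  - by move=> x; rewrite /= /excess ge_max ler01 andbT (le_trans _ (g1 x))// gerBl ltW.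
  - move=> x nVx; rewrite /= /excess max_r// subr_le0 leNgt; apply/negP => /ltW egx.
    exact/nVx/KV.
apply: (@le_trans _ _ (e * N)%:E).
  apply: rho_le => //; first exact: (Aplus_trunc (ltW e0) g0).2.
  by move=> x; rewrite /= /trunc ge_min lexx orbT.
by rewrite lee_fin /e mulrAC ler_pdivrMr// ler_pM2l// lerDl.
Qed.

Lemma induced_massU C K : compact C -> compact K -> C `&` K = set0 ->
  induced_mass (C `|` K) = induced_mass C + induced_mass K.
Proof.
move=> cC cK CK0.
(* All open neighbourhoods are shrunk into the disjoint [A] and [B]. *)
have [A [B [oA oB CA KB AB0]]] := @compact_separation R _ _ _ lcX hX cC cK CK0.
have oC := compact_oc hX cC; have oK := compact_oc hX cK.
have oCK := compact_oc hX (compactU cC cK).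
have ABI U V : (U `&` A) `&` (V `&` B) = set0 by rewrite setIACA AB0 setI0.
have fin D : open_or_closed D -> induced_mass D \is a fin_num.
  move=> oD; rewrite ge0_fin_numE ?induced_mass_ge0//.
  apply: (@le_lt_trans _ _ (open_mass setT)).
    by apply: induced_mass_le => //; exact: openT.
  by apply: (le_lt_trans (open_mass_le_norm _)); exact: ltry.
have adh D (e : R) : open_or_closed D -> (0 < e)%R -> exists U,
    [/\ open U, D `<=` U & open_mass U <= induced_mass D + e%:E].
  move=> oD e0; have := fin _ oD; rewrite induced_mass_inf// => fD.
  have [_ [U [oU DU] <-] Ue] := lb_ereal_inf_adherent e0 fD.
  by exists U; split => //; exact: ltW.
apply/eqP; rewrite eq_le; apply/andP; split.
  apply/lee_addgt0Pr => e e0; have e20 : (0 < e / 2)%R by rewrite divr_gt0.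
  have [U [oU CU Ue]] := adh _ _ oC e20; have [V [oV KV Ve]] := adh _ _ oK e20.
  apply: (@le_trans _ _ (open_mass U + open_mass V)); last first.
    by apply: le_trans (leeD Ue Ve) _; rewrite addeACA -EFinD -splitr.
  apply: (@le_trans _ _ (open_mass ((U `&` A) `|` (V `&` B)))).
    apply: induced_mass_le => //.
      by apply: openU; exact: openI.
    by move=> x [Cx|Kx]; [left; split; [exact: CU|exact: CA]|right; split; [exact: KV|exact: KB]].
  rewrite open_massU//; try exact: openI.
  by apply: leeD; apply: le_open_mass; exact: subIsetl.
rewrite [leRHS]induced_mass_inf//; apply: le_ereal_inf_tmp => _ [W [oW CKW] <-].
apply: (@le_trans _ _ (open_mass ((W `&` A) `|` (W `&` B)))).
  rewrite open_massU//; try exact: openI.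
  apply: leeD; apply: induced_mass_le => //; try exact: openI.
    by move=> x Cx; split; [apply: CKW; left|exact: CA].
  by move=> x Kx; split; [apply: CKW; right|exact: KB].
by apply: le_open_mass; rewrite -setIUr; exact: subIsetl.
Qed.

Lemma induced_mass_DTM : DTM R X induced_mass.
Proof.
split.
- split.
  + by move=> A _; exact: induced_mass_ge0.
  + exact: induced_massU.
  + exact: induced_mass_inner.
  + move=> F cF; rewrite induced_mass_inf; last by right.
    congr ereal_inf; apply: eq_imagel => U [oU _].
    by rewrite induced_mass_open.
- rewrite induced_mass_open; last exact: openT.
  by apply: (le_lt_trans (open_mass_le_norm _)); exact: ltry.
- by move=> A nA; rewrite /induced_mass; case: pselect.
Qed.

(** Both functionals are squeezed by the same set function. *)
Lemma Pi_induced_mass : Pi induced_mass = rho.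
Proof.
have iD := induced_mass_DTM.
apply/funext => f; have [f0|nf] := pselect (C0plus R X f); last first.
  by rewrite Pi_out//; case: rhoP => _ _ ->.
have [pc _ _] := Pi_Phiplus hX cX lcX iD.
pose m U := fine (induced_mass U).
have mE U : (m U)%:E = induced_mass U by rewrite /m fineK// (DTM_fin _ iD).
have m0 U : (0 <= m U)%R by rewrite -lee_fin mE induced_mass_ge0.
have d1 : dominates m rho.
  move=> U g oU g0 g1 gU; rewrite mE induced_mass_open//.
  by apply: ereal_sup_ubound; exists g.
have d2 : dominated m rho.
  move=> U g oU g0 gU; rewrite mE induced_mass_open//.
  apply: ge_ereal_sup => _ [h [h0 h1 hU] <-]; have [_ _ p2 _] := cq.
  apply: p2 => // x; have [Ux|/hU ->] := pselect (U x); last exact: g0.2.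
  by rewrite (le_trans (h1 x))// gU.
have d3 : dominates m (Pi induced_mass).
  by move=> U g oU g0 g1 gU; rewrite mE; exact: Pi_le_supp.
have d4 : dominated m (Pi induced_mass).
  by move=> U g oU g0 gU; rewrite mE; apply: Pi_ge_supp => //; left.
by apply/eqP; rewrite eq_le !(conic_squeeze (m := m)).
Qed.

End surjectivity.

Section bijection.
Context {R : realType} {X : ptopologicalType}.

(** Injectivity is antisymmetry of the order on set functions, which [Pi] reflects. *)
Lemma Pi_bij : locally_compact [set: X] -> hausdorff_space X ->
  connected [set: X] -> set_bij (DTM R X) (Phiplus R X) (@Pi R X).
Proof.
move=> lcX hX cX; split.
- by move=> mu muD; exact: Pi_Phiplus.
- move=> mu nu /set_mem muD /set_mem nuD E.
  have E1 : le_on (C0plus R X) (Pi mu) (Pi nu) by rewrite E => f _; exact: lexx.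
  have E2 : le_on (C0plus R X) (Pi nu) (Pi mu) by rewrite E => f _; exact: lexx.
  clear E; apply/funext => A; have [oA|nA] := pselect (open_or_closed A).
    apply: le_anti; rewrite ((Pi_order hX lcX muD nuD).2 E1 A oA).
    exact: ((Pi_order hX lcX nuD muD).2 E2 A oA).
  have [_ _ z1] := muD; have [_ _ z2] := nuD.
  by rewrite (z1 A nA) (z2 A nA).
- move=> rho rhoP; exists (induced_mass rho); first exact: induced_mass_DTM.
  exact: Pi_induced_mass.
Qed.

End bijection.

(** * Linear functionals and regular Borel measures *)

Lemma fin_num_cancel (R : realDomainType) (a b c d p q : \bar R) :
  (a \is a fin_num -> b \is a fin_num -> c \is a fin_num -> d \is a fin_num ->
  p \is a fin_num -> q \is a fin_num ->
  a + d + q = b + c + p -> a - b = (c - d) + (p - q))%E.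
Proof.
case: a => // a _; case: b => // b _; case: c => // c _; case: d => // d _.
case: p => // p _; case: q => // q _ [H]; congr _%:E; move: H; lra.
Qed.

Lemma fin_num_subD (R : realDomainType) (a b c d : \bar R) :
  (a \is a fin_num -> b \is a fin_num -> c \is a fin_num -> d \is a fin_num ->
  (a + c) - (b + d) = (a - b) + (c - d))%E.
Proof.
case: a => // a _; case: b => // b _; case: c => // c _; case: d => // d _.
congr _%:E; ring.
Qed.

Section signed_extension.
Local Opaque Pi.
Local Open Scope ereal_scope.
Context {R : realType} {X : ptopologicalType}.
Hypotheses (hX : hausdorff_space X) (cX : connected [set: X])
  (lcX : locally_compact [set: X]).
Implicit Types (f g h : X -> R) (U V W : set X).
Variable mu : set X -> \bar R.
Hypothesis muD : DTM R X mu.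

Definition signed_Pi (nu : set X -> \bar R) f := Pi nu (f^\+)%R - Pi nu (f^\-)%R.

Lemma signed_PiE nu f : signed_Pi nu f = Pi nu (f^\+)%R - Pi nu (f^\-)%R.
Proof. by []. Qed.

Let Pf f : Pi mu f \is a fin_num. Proof. exact: Pi_fin. Qed.

Lemma signed_Pi_fin f : signed_Pi mu f \is a fin_num.
Proof. by rewrite /signed_Pi fin_numB; apply/andP; split; exact: Pf. Qed.

Lemma Pi0 : Pi mu (cst 0%R) = 0.
Proof.
have := Pi_scale cX muD C0plus0 (lexx 0%R); rewrite mul0e => <-.
by congr Pi; apply/funext => x; rewrite mul0r.
Qed.

Lemma signed_Pi_pos f : (forall x, 0 <= f x)%R -> signed_Pi mu f = Pi mu f.
Proof.
move=> f0; rewrite /signed_Pi.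
have -> : (f^\+)%R = f by apply/funext => x; rewrite /funrpos max_l.
have -> : (f^\-)%R = cst 0%R.
  by apply/funext => x; rewrite /funrneg max_r// oppr_le0.
by rewrite Pi0 sube0.
Qed.

Lemma signed_Pi_scale (a : R) f : C0 R X f ->
  signed_Pi mu (fun x => a * f x)%R = a%:E * signed_Pi mu f.
Proof.
move=> f0; have fp := C0_pos f0; have fn := C0_neg f0.
rewrite /signed_Pi; have [a0|a0] := leP 0%R a.
  have -> : (((fun x => a * f x)^\+) = (fun x => a * (f^\+) x))%R.
    by apply/funext => x; rewrite /funrpos maxr_pMr// mulr0.
  have -> : (((fun x => a * f x)^\-) = (fun x => a * (f^\-) x))%R.
    by apply/funext => x; rewrite /funrneg maxr_pMr// mulr0 mulrN.
  by rewrite !(Pi_scale cX)// muleBr// fin_num_adde_defr.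
have a0' : (0 <= - a)%R by rewrite oppr_ge0 ltW.
have -> : (((fun x => a * f x)^\+) = (fun x => - a * (f^\-) x))%R.
  by apply/funext => x; rewrite /funrpos /funrneg maxr_pMr// mulr0 mulrNN.
have -> : (((fun x => a * f x)^\-) = (fun x => - a * (f^\+) x))%R.
  by apply/funext => x; rewrite /funrpos /funrneg maxr_pMr// mulr0 mulNr.
rewrite (Pi_scale cX muD fn a0') (Pi_scale cX muD fp a0').
move: (Pf (f^\+)%R) (Pf (f^\-)%R).
case: (Pi mu (f^\+)%R) => // p _; case: (Pi mu (f^\-)%R) => // q _.
by rewrite -!EFinM -!EFinN -!EFinD; congr _%:E; ring.
Qed.

(** Additivity on a cone of nonnegative functions passes to differences: the positive
    and negative parts satisfy (f+g)^+ + f^- + g^- = (f+g)^- + f^+ + g^+. *)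
Lemma signed_Pi_add (P : set (X -> R)) f g :
  (forall u v, P u -> P v -> P (fun x => u x + v x)%R) ->
  (forall u v, P u -> P v -> Pi mu (fun x => u x + v x)%R = Pi mu u + Pi mu v) ->
  P (f^\+)%R -> P (f^\-)%R -> P (g^\+)%R -> P (g^\-)%R ->
  P ((fun x => f x + g x)^\+)%R -> P ((fun x => f x + g x)^\-)%R ->
  signed_Pi mu (fun x => f x + g x)%R = signed_Pi mu f + signed_Pi mu g.
Proof.
move=> PD PiD fp fn gp gn sp sn; set s := (fun x => f x + g x)%R.
have E : (fun x => (fun x => s^\+ x + f^\- x) x + g^\- x)%R =
    (fun x => (fun x => s^\- x + f^\+ x) x + g^\+ x)%R.
  apply/funext => x.
  have d u : (u^\+ x = u x + u^\- x)%R.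
    rewrite /funrpos /funrneg; have [u0|u0] := leP 0%R (u x).
      by rewrite max_r ?addr0// oppr_le0.
    by rewrite max_l ?subrr// oppr_ge0 ltW.
  by rewrite !d /s; ring.
have := congr1 (Pi mu) E.
rewrite (PiD _ _ (PD _ _ sp fn) gn) (PiD _ _ sp fn).
rewrite (PiD _ _ (PD _ _ sn fp) gp) (PiD _ _ sn fp) /signed_Pi -/s.
by apply: fin_num_cancel.
Qed.

End signed_extension.

Section measures.
Local Open Scope ereal_scope.
Context {R : realType} {X : ptopologicalType}.
Hypotheses (hX : hausdorff_space X) (cX : connected [set: X])
  (lcX : locally_compact [set: X]).
Implicit Types (f g h : X -> R) (U V W : set X).
Variable mu : set X -> \bar R.
Hypothesis muD : DTM R X mu.

Lemma measurable_C0 f : continuous f ->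
  measurable_fun [set: g_sigma_algebraType (@open X)] f.
Proof.
move=> cf; apply: (measurability (@RGenOInfty.G R)) => [|/= _ [_ [a ->] <-]].
  exact: RGenOInfty.measurableE.
rewrite setTI; apply: sub_sigma_algebra.
by move/continuousP : cf; apply; exact: interval_open.
Qed.

Lemma Mreg_linear : Mreg R X mu -> linear_functional (signed_Pi mu).
Proof.
move=> [_ [m [mT _ _ mE]]]; split.
- by move=> f _; exact: signed_Pi_fin.
- by move=> a f f0; exact: signed_Pi_scale.
move=> f g f0 g0.
have PiE u : C0plus R X u -> Pi mu u = \int[m]_x (u x)%:E.
  move=> u0; apply: Pi_layer => //; first exact: measurable_C0 u0.1.1.
    exact: u0.2.
  by move=> t t0; rewrite mE//; left; apply: open_superlevel; exact: u0.1.1.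
apply: (signed_Pi_add cX muD (P := C0plus R X)).
- move=> u v [u0 up] [v0 vp]; split; first exact: C0_add.
  by move=> x; rewrite addr_ge0.
- move=> u v u0 v0; rewrite !PiE//; last first.
    by split; [apply: C0_add; [exact: u0.1|exact: v0.1]|move=> x; rewrite addr_ge0 ?u0.2 ?v0.2].
  rewrite -ge0_integralD//.
  + by move=> x _; rewrite lee_fin u0.2.
  + by apply/measurable_EFinP; exact: measurable_C0 u0.1.1.
  + by move=> x _; rewrite lee_fin v0.2.
  + by apply/measurable_EFinP; exact: measurable_C0 v0.1.1.
- exact: C0_pos.
- exact: C0_neg.
- exact: C0_pos.
- exact: C0_neg.
- by apply: C0_pos; exact: C0_add.
- by apply: C0_neg; exact: C0_add.
Qed.

Hypothesis lin : linear_functional (signed_Pi mu).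

Lemma linear_Pi_add f g : C0plus R X f -> C0plus R X g ->
  Pi mu (fun x => f x + g x)%R = Pi mu f + Pi mu g.
Proof.
move=> f0 g0; have [_ _ /(_ f g f0.1 g0.1)] := lin.
rewrite !(signed_Pi_pos cX muD)//; [exact: g0.2|exact: f0.2|].
by move=> x; rewrite addr_ge0 ?f0.2 ?g0.2.
Qed.

(** A compact subset of the union is covered by two functions [F] and [g], bounded
    by 1 and vanishing off [U] and off [V] respectively, with sum at least 1 on it. *)
Lemma linear_openU U V : open U -> open V -> mu (U `|` V) <= mu U + mu V.
Proof.
move=> oU oV; have [[_ _ iro _] _ _] := muD.
rewrite (iro _ (openU oU oV)); apply: ge_ereal_sup => _ [D [cD DUV] <-].
have cDV : compact (D `\` V).
  apply: (subclosed_compact _ cD); last exact: subDsetl.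
  by apply: closedI; [exact: compact_closed|exact: open_closedC].
have DVU : D `\` V `<=` U by move=> x [/DUV[]].
have [f [f0 f1 fD fU]] := @urysohn_C0plus R _ _ _ lcX hX cDV oU DVU.
(* [F] is 1 where [f >= 1/2]; the rest of [D] is compact and lies inside [V]. *)
pose F x := Num.min (2 * f x)%R 1%R.
have F0 : C0plus R X F.
  apply: (C0plus_dom (c := 2) f0).
    move=> x; apply: (@continuous_comp X R R f (fun s => Num.min (2 * s)%R 1%R)).
      exact: f0.1.1.
    apply: continuous_minr => s; apply: cvgM; [exact: cvg_cst|exact: cvg_id].
  by move=> x; rewrite /F le_min mulr_ge0 ?f0.2// ler01/= ge_min lexx.
pose E := D `&` [set x | (f x <= 2^-1)%R].
have cE : compact E.
  apply: (subclosed_compact _ cD); last exact: subIsetl.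
  apply: closedI; first exact: compact_closed.
  rewrite (_ : [set x | _] = ~` [set x | (2^-1 < f x)%R]).
    by apply: open_closedC; apply: open_superlevel; exact: f0.1.1.
  by apply/seteqP; split => x /=; rewrite leNgt => /negP.
have EV : E `<=` V.
  move=> x [Dx /= fx]; apply: contrapT => nVx; move: fx; rewrite fD//.
  by rewrite leNgt invf_lt1// ltr1n.
have [g [g0 g1 gE gV]] := @urysohn_C0plus R _ _ _ lcX hX cE oV EV.
have FD : C0plus R X (fun x => F x + g x)%R.
  by split; [apply: C0_add; [exact: F0.1|exact: g0.1]|move=> x; rewrite addr_ge0 ?F0.2 ?g0.2].
apply: (@le_trans _ _ (Pi mu (fun x => F x + g x)%R)).
  apply: Pi_ge_supp => //; first exact: compact_oc.
  move=> x Dx; have [fx|fx] := leP (f x) 2^-1%R.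
    by rewrite gE// ler_wpDl// F0.2.
  rewrite ler_wpDr ?g0.2// /F le_min lexx andbT.
  by rewrite mulrC -ler_pdivrMr// mul1r ltW.
rewrite linear_Pi_add//; apply: leeD.
  apply: Pi_le_supp => //; first by move=> x; rewrite /F ge_min lexx orbT.
  by move=> x /fU fx; rewrite /F fx mulr0 min_l.
exact: Pi_le_supp.
Qed.

(** A compact subset of the union lies in a finite subunion. *)
Lemma linear_open_bigcup (F : (set X)^nat) : (forall n, open (F n)) ->
  mu (\bigcup_n F n) <= \sum_(n <oo) mu (F n).
Proof.
move=> oF; have [[_ _ iro _] _ _] := muD.
have oB n : open (\big[setU/set0]_(i < n) F i).
  by rewrite -bigcup_mkord; apply: bigcup_open => i _.
have fin n : mu (\big[setU/set0]_(i < n) F i) <= \sum_(i < n) mu (F i).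
  elim: n => [|n IH]; first by rewrite !big_ord0 (DTM_set0 muD).
  rewrite !big_ord_recr/= (le_trans (linear_openU (oB n) (oF n)))//.
  by rewrite leeD2r.
rewrite (iro _ (bigcup_open (fun n _ => oF n))).
apply: ge_ereal_sup => _ [D [cD DF] <-].
have [D' _ DD'] : finite_subset_cover [set: nat] F D.
  by move: cD; rewrite compact_cover; apply.
have [n nD'] : exists n, forall i, i \in D' -> (i < n)%N.
  exists (\sum_(i <- D') i.+1)%N => i iD'.
  by rewrite (big_rem i)//= ltn_addr.
apply: (@le_trans _ _ (mu (\big[setU/set0]_(i < n) F i))).
  apply: (DTM_le muD); [exact: compact_oc|by left|].
  move=> x /DD' [i /= /nD' ni Fx]; rewrite -bigcup_mkord.
  by exists i.
apply: (le_trans (fin n)); rewrite -(big_mkord xpredT (fun i => mu (F i))).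
by apply: nneseries_lim_ge => i _ _; exact: DTM_ge0.
Qed.

(** The outer measure generated by a set function on open sets. *)
Definition outer_ext (nu : set X -> \bar R) (A : set X) : \bar R :=
  ereal_inf [set nu U | U in [set U | open U /\ A `<=` U]].

Lemma outer_ext_oc A : open_or_closed A -> outer_ext mu A = mu A.
Proof.
move=> [oA|cA]; last by have [[_ _ _ orc] _ _] := muD; rewrite (orc _ cA).
apply/eqP; rewrite eq_le; apply/andP; split.
  by apply: ereal_inf_lbound; exists A => //; split.
apply: le_ereal_inf_tmp => _ [U [oU AU] <-].
by apply: (DTM_le muD) => //; left.
Qed.

Lemma outer_ext_ge0 A : 0 <= outer_ext mu A.
Proof. by apply: le_ereal_inf_tmp => _ [U _ <-]; exact: DTM_ge0. Qed.

Lemma outer_ext_le A U : open U -> A `<=` U -> outer_ext mu A <= mu U.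
Proof. by move=> oU AU; apply: ereal_inf_lbound; exists U. Qed.

Lemma outer_ext_mono : {homo outer_ext mu : A B / A `<=` B >-> A <= B}.
Proof.
move=> A B AB; apply: le_ereal_inf_tmp => _ [U [oU BU] <-].
by apply: outer_ext_le => //; exact: subset_trans BU.
Qed.

Lemma outer_ext_fin A : outer_ext mu A \is a fin_num.
Proof.
rewrite ge0_fin_numE ?outer_ext_ge0// (le_lt_trans (outer_ext_le openT _))//.
by case: muD.
Qed.

Lemma outer_ext_adherent A (e : R) : (0 < e)%R ->
  exists U, [/\ open U, A `<=` U & mu U <= outer_ext mu A + e%:E].
Proof.
move=> e0; have [_ [U [oU AU] <-] Ue] := lb_ereal_inf_adherent e0 (outer_ext_fin A).
by exists U; split => //; exact: ltW.
Qed.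

Lemma outer_ext_subadditive : sigma_subadditive (outer_ext mu).
Proof.
move=> F; apply/lee_addgt0Pr => e e0.
have en n : (0 < e / (2 ^ n.+1)%:R)%R by rewrite divr_gt0// ltr0n expn_gt0.
have /choice [U UP] : forall n, exists U,
    [/\ open U, F n `<=` U & mu U <= outer_ext mu (F n) + (e / (2 ^ n.+1)%:R)%:E].
  by move=> n; exact: outer_ext_adherent.
apply: (@le_trans _ _ (\sum_(n <oo) mu (U n))).
  apply: (@le_trans _ _ (mu (\bigcup_n U n))).
    apply: outer_ext_le.
      by apply: bigcup_open => n _; case: (UP n).
    by move=> x [n _ Fx]; exists n => //; case: (UP n) => _ FU _; exact: FU.
  by apply: linear_open_bigcup => n; case: (UP n).
apply: le_trans (epsilon_trick _ _ _) => //; last exact: ltW.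
  apply: lee_nneseries => [n _ _|n _]; first exact: DTM_ge0.
  by case: (UP n).
by move=> n; exact: outer_ext_ge0.
Qed.

(** Open sets are Caratheodory measurable already by superadditivity and inner
    regularity; linearity is what makes the extension an outer measure. *)
Lemma linear_Mreg : Mreg R X mu.
Proof.
pose om : {outer_measure set X -> \bar R} := HB.pack (outer_ext mu)
  (isOuterMeasure.Build R X (outer_ext mu)
    (etrans (outer_ext_oc (or_introl open0)) (DTM_set0 muD))
    outer_ext_ge0 outer_ext_mono outer_ext_subadditive).
have open_cara U : open U -> om.-caratheodory U.
  move=> oU; apply: le_caratheodory_measurable => A.
  apply: le_ereal_inf_tmp => _ [W [oW AW] <-].
  apply/lee_addgt0Pr => e e0.
  have [K [cK KU Ke]] := DTM_inner muD (openI oW oU) e0.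
  have oK : open (W `&` ~` K).
    by apply: openI => //; apply: closed_openC; exact: compact_closed.
  apply: (@le_trans _ _ (mu (W `&` U) + mu (W `&` ~` K))).
    apply: leeD; apply: outer_ext_le => //; first exact: openI.
      by move=> x [/AW].
    by move=> x [/AW Wx nUx]; split => // /KU[].
  apply: (@le_trans _ _ (mu K + mu (W `&` ~` K) + e%:E)).
    by rewrite addeAC leeD2r.
  rewrite leeD2r//; apply: (DTM_super hX muD); [by left|by right|by left|..].
  - by rewrite -subset0 => x [Kx [_]].
  - by move=> x /KU[].
  - by move=> x [].
(* The outer measure is a measure on the Borel sets, as they are measurable for it. *)
have sub : (@open X).-sigma.-measurable `<=` om.-caratheodory.
  apply: smallest_sub; last exact: open_cara.
  split.
  - exact: caratheodory_measurable_set0.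
  - by move=> A mA; rewrite setTD; exact: caratheodory_measurable_setC.
  - by move=> F mF; exact: caratheodory_measurable_bigcup.
have sadd : semi_sigma_additive (outer_ext mu : set (g_sigma_algebraType (@open X)) -> _).
  move=> F mF tF mU; apply: (@caratheodory_measure_sigma_additive R X om) => //.
  - by move=> i; apply: sub; exact: mF.
  - exact: sub.
pose m : {measure set (g_sigma_algebraType (@open X)) -> \bar R} :=
  HB.pack (outer_ext mu : set (g_sigma_algebraType (@open X)) -> _)
   (isMeasure.Build _ (g_sigma_algebraType (@open X)) R (outer_ext mu)
    (etrans (outer_ext_oc (or_introl open0)) (DTM_set0 muD)) outer_ext_ge0 sadd).
have mE A : open_or_closed A -> m A = mu A by exact: outer_ext_oc.
have [[_ _ iro _] muT muz] := muD.
split => //; exists m; split.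
- by rewrite mE//; left; exact: openT.
- move=> U oU; rewrite mE; last by left.
  rewrite (iro _ oU); congr ereal_sup; apply: eq_imagel => K [cK _].
  by rewrite mE//; exact: compact_oc.
- move=> A mA; congr ereal_inf; apply: eq_imagel => U [oU _].
  by rewrite mE//; left.
- by move=> A oA; rewrite mE.
Qed.

End measures.

(** * From quasi-linear functionals to topological measures *)

Section from_quasi_linear_to_topological_measure.
Local Opaque Pi signed_Pi.
Local Open Scope ereal_scope.
Context {R : realType} {X : ptopologicalType}.
Hypotheses (hX : hausdorff_space X) (cX : connected [set: X])
  (lcX : locally_compact [set: X]).
Implicit Types (f g h : X -> R) (U V W : set X).
Variable mu : set X -> \bar R.
Hypothesis muD : DTM R X mu.

Lemma Balg_lin h f g (a b : R) : Balg h f -> Balg h g ->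
  Balg h (fun x => a * f x + b * g x)%R.
Proof.
move=> hf hg A hA; have [[_ _ A3 _ _] _] := hA.
by apply: A3; [exact: (hf _ hA)|exact: (hg _ hA)].
Qed.

Lemma Balg_mul h f g : Balg h f -> Balg h g -> Balg h (f \* g)%R.
Proof.
move=> hf hg A hA; have [[_ _ _ A4 _] _] := hA.
by apply: A4; [exact: (hf _ hA)|exact: (hg _ hA)].
Qed.

Lemma Balg_id h : Balg h h.
Proof. by move=> A [_ hA]; apply: hA; left. Qed.

(** [h ^ n] and [1 - (1 - h) ^ n] are polynomials in [h] without constant term, so they
    belong to every algebra containing [h], unital or not. *)
Lemma poly_closed (P : set (X -> R)) h n :
  (forall (a b : R) f g, P f -> P g -> P (fun x => a * f x + b * g x)%R) ->
  (forall f g, P f -> P g -> P (fun x => f x * g x)%R) -> P h ->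
  P (fun x => h x ^+ n.+1)%R /\ P (fun x => 1 - (1 - h x) ^+ n.+1)%R.
Proof.
move=> Plin Pmul Ph; elim: n => [|n [IH1 IH2]].
  split; first by [].
  rewrite (_ : (fun _ => _) = h)//; apply/funext => x; rewrite expr1; ring.
split.
  rewrite (_ : (fun _ => _) = (fun x => h x * h x ^+ n.+1)%R); first exact: Pmul.
  by apply/funext => x; rewrite exprS.
have := Plin 1%R (-1)%R _ _ (Plin 1%R 1%R _ _ IH2 Ph) (Pmul _ _ IH2 Ph).
congr P; apply/funext => x; rewrite [in RHS]exprS; ring.
Qed.

Hypothesis ql : quasi_linear_functional (signed_Pi mu).

Lemma half_pow_small (c d : R) : (0 <= c)%R -> (0 < d)%R ->
  exists n, (c * 2^-1 ^+ n.+1 <= d)%R.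
Proof.
move=> c0 d0; have [n cn] := ex_nat_gt (c / d); exists n.
rewrite exprVn ler_pdivrMr ?exprn_gt0// mulrC -ler_pdivrMr// (le_trans (ltW cn))//.
by rewrite -natrX ler_nat (leq_trans (ltnW (ltnSn n)))// ltnW// ltn_expl.
Qed.

(** With [s] the mean of an Urysohn function of [D] in [U] and one of [K] in [W],
    let [a = s ^ n] and [T = 1 - (1 - s) ^ n].  Quasi-linearity splits [T] into [a] and
    [b = T - a], with values in [0, 1].  As [n] grows, [T] tends to 1 on [D], where
    [s >= 1/2], and [a] is small off [W], where [s <= 1/2], while [b] vanishes exactly
    where needed: off [U], where [s = 0], and on [K], where [s = 1]. *)
Lemma quasi_linear_bump D K U W : compact D -> compact K -> open U -> open W ->
  K `<=` D -> D `<=` U -> K `<=` W -> W `<=` U ->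
  mu D <= mu W + mu (U `&` ~` K).
Proof.
move=> cD cK oU oW KD DU KW WU.
have oUK : open (U `&` ~` K).
  by apply: openI => //; apply: closed_openC; exact: compact_closed.
have [f [f0 f1 fD fU]] := @urysohn_C0plus R _ _ _ lcX hX cD oU DU.
have [g [g0 g1 gK gW]] := @urysohn_C0plus R _ _ _ lcX hX cK oW KW.
pose s x := (2^-1 * f x + 2^-1 * g x)%R.
have s0 : C0plus R X s by exact: C0plus_lin.
have s1 x : (0 <= s x <= 1)%R.
  rewrite s0.2/=; have := f1 x; have := g1 x; rewrite /s; lra.
have sD x : D x -> (1 - s x <= 2^-1)%R.
  by move=> /fD; have := g0.2 x; rewrite /s => ? ->; lra.
have sK x : K x -> s x = 1%R.
  by move=> Kx; rewrite /s gK// fD; [lra|exact: KD].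
have sU x : ~ U x -> s x = 0%R.
  by move=> nU; rewrite /s fU// gW; [lra|move=> /WU].
have sW x : ~ W x -> (s x <= 2^-1)%R.
  by move=> nW; have := f1 x; rewrite /s gW//; lra.
have s01 x : (0 <= 1 - s x <= 1)%R by have := s1 x; lra.
apply/lee_addgt0Pr => d d0.
have [n nd] := half_pow_small (addr_ge0 (fine_ge0 (DTM_ge0 D muD))
  (fine_ge0 (DTM_ge0 setT muD))) d0.
(* [q] bounds both [1 - T] on [D] and [a] off [W]. *)
set q := (2^-1 ^+ n.+1)%R in nd.
have q01 : (0 <= q <= 1)%R.
  by rewrite /q exprn_ge0//= exprn_ile1// invf_le1// ler1n.
pose a x := (s x ^+ n.+1)%R; pose T x := (1 - (1 - s x) ^+ n.+1)%R.
pose b x := (1 * T x + (- 1) * a x)%R.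
have [Ba BT] : Balg s a /\ Balg s T.
  apply: (poly_closed (P := Balg s)); last exact: Balg_id.
    by move=> c1 c2 u v; exact: Balg_lin.
  by move=> u v; exact: Balg_mul.
have [a0 T0] : C0 R X a /\ C0 R X T.
  apply: poly_closed; [|exact: C0_mul|exact: s0.1].
  by move=> c1 c2 u v u0 v0; exact: C0_lin.
have b0 : C0 R X b by exact: C0_lin.
have Bb : Balg s b by exact: Balg_lin.
have a01 x : (0 <= a x <= s x)%R.
  have /andP[h1 h2] := s1 x; rewrite /a exprn_ge0//= exprS -[leRHS]mulr1.
  by rewrite ler_wpM2l// exprn_ile1.
have T01 x : (s x <= T x <= 1)%R.
  have /andP[h1 h2] := s01 x; rewrite /T lerBrDl -lerBrDr.
  rewrite lerBlDr lerDl exprn_ge0// andbT exprS -[leRHS]mulr1.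
  by rewrite ler_wpM2l// exprn_ile1.
have b01 x : (0 <= b x <= 1)%R.
  by have := a01 x; have := T01 x; rewrite /b; lra.
have aP : C0plus R X a by split; [by []|move=> x; case/andP: (a01 x)].
have bP : C0plus R X b by split; [by []|move=> x; case/andP: (b01 x)].
have TP : C0plus R X T.
  by split; [by []|move=> x; have := s1 x; have := T01 x; lra].
have addT : Pi mu T = Pi mu b + Pi mu a.
  have Eab : signed_Pi mu (fun x => b x + a x)%R = signed_Pi mu b + signed_Pi mu a.
    by case: ql => _ _ badd _; exact: (badd s s0.1).
  have Tab : T = (fun x => b x + a x)%R by apply/funext => x; rewrite /b; ring.
  rewrite -(signed_Pi_pos cX muD bP.2) -(signed_Pi_pos cX muD aP.2) -Eab -Tab.
  by rewrite (signed_Pi_pos cX muD TP.2).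
have TD : (1 - q)%:E * mu D <= Pi mu T.
  apply: Pi_ge_on => //; [exact: compact_oc|lra|].
  move=> x Dx; rewrite /T lerD2l lerN2 /q lerXn2r ?nnegrE ?invr_ge0//.
    by case/andP: (s01 x).
  exact: sD.
have aW : Pi mu a <= q%:E * mu setT + mu W.
  apply: Pi_le_open => //; first by case/andP: q01.
    by move=> x; have := a01 x; have := s1 x; lra.
  move=> x /sW sx; rewrite /a /q lerXn2r ?nnegrE ?invr_ge0//.
  by case/andP: (s1 x).
have bU : Pi mu b <= mu (U `&` ~` K).
  apply: Pi_le_supp => //; first by move=> x; case/andP: (b01 x).
  move=> x /not_andP[nU|]; rewrite /b /T /a.
    by rewrite sU// subr0 expr1n subrr expr0n/= !mulr0 addr0.
  by move=> /contrapT Kx; rewrite sK// subrr expr0n/= subr0 expr1n; lra.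
have := le_trans TD (eq_ind_r (fun z => z <= _) (leeD bU aW) addT).
move: nd; rewrite -(fineK (DTM_fin D muD)) -(fineK (DTM_fin setT muD)).
rewrite -(fineK (DTM_fin W muD)) -(fineK (DTM_fin (U `&` ~` K) muD)).
move: (fine (mu D)) (fine (mu setT)) (fine (mu W)) (fine (mu (U `&` ~` K))).
move=> mD mX mW mUK /= nd; rewrite -!EFinM -!EFinD !lee_fin.
move: nd; lra.
Qed.

Lemma quasi_linear_openD K U : compact K -> open U -> K `<=` U ->
  mu U <= mu K + mu (U `&` ~` K).
Proof.
move=> cK oU KU; have clK : closed K by exact: compact_closed.
apply/lee_addgt0Pr => e e0; have [W [oW KW We]] := DTM_outer muD clK e0.
apply: (@le_trans _ _ (mu (W `&` U) + mu (U `&` ~` K))); last first.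
  rewrite addeAC leeD2r//; apply: le_trans We; apply: (DTM_le muD).
  - by left; exact: openI.
  - by left.
  - exact: subIsetl.
have [[_ _ iro _] _ _] := muD; rewrite {1}(iro _ oU).
apply: ge_ereal_sup => _ [D [cD DU] <-].
apply: (@le_trans _ _ (mu (D `|` K))).
  apply: (DTM_le muD); [exact: compact_oc|apply: compact_oc => //; exact: compactU|].
  exact: subsetUl.
apply: quasi_linear_bump => //.
- exact: compactU.
- exact: openI.
- by move=> x [/DU|/KU].
- by move=> x Kx; split; [exact: KW|exact: KU].
Qed.

(** When the union is open this is [quasi_linear_openD].  When it is compact, its
    complement is open, and the claim follows by comparing the decompositions of the
    whole space by [K] and by the union. *)
Lemma quasi_linear_compactU K V : compact K -> open V -> K `&` V = set0 ->
  compact_or_open (K `|` V) -> mu (K `|` V) = mu K + mu V.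
Proof.
move=> cK oV KV0 coKV.
have ocKV : open_or_closed (K `|` V).
  by case: coKV => [cKV|oKV]; [exact: compact_oc|left].
apply/eqP; rewrite eq_le; apply/andP; split; last first.
  by apply: (DTM_super hX muD) => //; [left|right].
have oK : open (~` K) by apply: closed_openC; exact: compact_closed.
case: coKV => [cKV|oKV].
  have oC : open (~` (K `|` V)) by apply: closed_openC; exact: compact_closed.
  have E : ~` K = V `|` ~` (K `|` V).
    apply/seteqP; split => x /=.
      move=> nK; have [Vx|nV] := pselect (V x); first by left.
      by right => -[].
    by move=> [Vx Kx|nKV Kx]; [have : set0 x by rewrite -KV0|apply: nKV; left].
  have h1 : mu setT <= mu K + mu (~` K).
    have := quasi_linear_openD cK openT (@subsetT _ K).
    by rewrite setTI.
  have h2 : mu (~` K) = mu V + mu (~` (K `|` V)).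
    rewrite {1}E (DTM_openU hX muD)//.
    by rewrite -subset0 => x [Vx]; apply; right.
  have h3 : mu (K `|` V) + mu (~` (K `|` V)) <= mu setT.
    apply: (DTM_super hX muD) => //; [by left|by right|by left; exact: openT|].
    exact: setICr.
  have := le_trans h3 h1; rewrite h2 addeA leeD2rE//.
  exact: DTM_fin.
have := quasi_linear_openD cK oKV (@subsetUl _ K V).
congr (_ <= _ + mu _); apply/seteqP; split => x /=.
  by move=> [[//|//]].
by move=> Vx; split; [right|move=> Kx; have : set0 x by rewrite -KV0].
Qed.

Lemma quasi_linear_TM : TM R X mu.
Proof.
have [[mu0 muA iro orc] muT muz] := muD.
split => //; split => // A B [cA|oA] [cB|oB] coAB AB0.
- exact: muA.
- exact: quasi_linear_compactU.
- by rewrite setUC addeC; apply: quasi_linear_compactU; rewrite 1?setIC 1?setUC.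
- exact: (DTM_openU hX muD).
Qed.

End from_quasi_linear_to_topological_measure.

(** * Level sets under a topological measure *)

Section ereal_limits.
Context {R : realType}.
Local Open Scope ereal_scope.

Lemma cvge_le_bound (u : nat -> \bar R) (l b : \bar R) :
  u @ \oo --> l -> (forall n, u n <= b) -> l <= b.
Proof.
move=> ul ub; rewrite -(cvg_lim _ ul)//; apply: lime_le; first exact: cvgP ul.
by exists 0%N => // n _; exact: ub.
Qed.

Lemma cvge_ge_bound (u : nat -> \bar R) (l b : \bar R) :
  u @ \oo --> l -> (forall n, b <= u n) -> b <= l.
Proof.
move=> ul ub; rewrite -(cvg_lim _ ul)//; apply: lime_ge; first exact: cvgP ul.
by exists 0%N => // n _; exact: ub.
Qed.

Lemma leeD2rI (a x y : \bar R) : a \is a fin_num -> x + a <= y + a -> x <= y.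
Proof. by move=> fa; rewrite leeD2rE. Qed.

Lemma ex_invn_lt (e : R) : (0 < e)%R -> exists n : nat, (n.+1%:R^-1 < e)%R.
Proof.
move=> e0; have [n en] := ex_nat_gt e^-1; exists n.
rewrite -[ltRHS]invrK ltf_pV2 ?posrE ?invr_gt0//.
by rewrite (lt_trans en)// ltr_nat.
Qed.

End ereal_limits.

Section level_sets_of_topological_measures.
Local Open Scope ereal_scope.
Context {R : realType} {X : ptopologicalType}.
Hypotheses (hX : hausdorff_space X).
Implicit Types (f g : X -> R) (U V W : set X).
Variables (mu : set X -> \bar R) (h : X -> R).
Hypotheses (muD : DTM R X mu) (muT : TM R X mu) (hp : C0plus R X h).

Let ch : continuous h. Proof. exact: hp.1.1. Qed.

Let r := ls_measure (fun t => - R1 mu h t)%R.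

Let ray (a : R) : r `]a, +oo[%classic = mu [set x | (a < h x)%R].
Proof. by have [M _ hM] := C0_bounded hp.1; exact: (ls_rayE muD ch hM). Qed.

Let rT : r setT = mu setT.
Proof. by have [M _ hM] := C0_bounded hp.1; exact: (ls_setT muD ch hM). Qed.

Let rfin (A : set R) : measurable A -> r A \is a fin_num.
Proof.
move=> mA; rewrite ge0_fin_numE//; apply: (@le_lt_trans _ _ (r setT)).
  by apply: le_measure; rewrite ?inE.
by rewrite rT; case: muD.
Qed.

Let tmU A B : compact_or_open A -> compact_or_open B ->
  compact_or_open (A `|` B) -> A `&` B = set0 -> mu (A `|` B) = mu A + mu B.
Proof. by case: muT => -[_ muU _ _] _ _; exact: muU. Qed.

(** Continuity from above of the Stieltjes measure along the rays above [b - 1/n]. *)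
Lemma level_ge_le (b : R) : (0 < b)%R ->
  mu [set x | (b <= h x)%R] <= r `[b, +oo[%classic.
Proof.
move=> b0; pose F n : set (measurableTypeR R) := `](b - n.+1%:R^-1)%R, +oo[%classic.
have FE : `[b, +oo[%classic = \bigcap_n F n.
  apply/seteqP; split => s /=.
    rewrite in_itv/= andbT => bs n _; rewrite /F/= in_itv/= andbT.
    by rewrite (lt_le_trans _ bs)// gtrDl oppr_lt0.
  move=> H; rewrite in_itv/= andbT leNgt; apply/negP => sb.
  have [n nb] : exists n, (n.+1%:R^-1 < b - s)%R by apply: ex_invn_lt; rewrite subr_gt0.
  have := H n I; rewrite /F/= in_itv/= andbT ltrBlDr -ltrBlDl.
  by move=> /lt_trans /(_ nb); rewrite ltxx.
have c1 : r \o F @ \oo --> r (\bigcap_n F n).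
  apply: nonincreasing_cvg_mu => //.
  - by rewrite -ge0_fin_numE// rfin//; exact: measurable_itv.
  - by move=> n; exact: measurable_itv.
  - by apply: bigcapT_measurable => n; exact: measurable_itv.
  - move=> m n mn; apply/subsetPset => s; rewrite /F/= !in_itv/= !andbT.
    by apply: le_lt_trans; rewrite lerD2l lerN2 lef_pV2 ?posrE// ler_nat.
rewrite [in leRHS]FE; apply: (cvge_ge_bound c1) => n /=.
rewrite /F ray; apply: (DTM_le muD).
- by apply: compact_oc => //; exact: compact_superlevel.
- exact: superlevel_oc.
- by move=> x /=; apply: lt_le_trans; rewrite gtrDl oppr_lt0.
Qed.

(** This is where additivity on mixed compact and open sets enters. *)
Lemma level_gt_split (a b : R) : (0 < b)%R -> (a < b)%R ->
  mu [set x | (a < h x)%R] =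
  mu [set x | (a < h x < b)%R] + mu [set x | (b <= h x)%R].
Proof.
move=> b0 ab.
have E : [set x | (a < h x)%R] = [set x | (a < h x < b)%R] `|` [set x | (b <= h x)%R].
  apply/seteqP; split => x /=.
    by move=> ->; have [|] := ltP (h x) b; [left|right].
  by move=> [/andP[]//|]; exact: lt_le_trans.
rewrite E tmU//.
- right; rewrite (_ : [set x | _] = [set x | (a < h x)%R] `&` [set x | (h x < b)%R]).
    by apply: openI; [exact: open_superlevel|exact: open_sublevel].
  by apply/seteqP; split => x /=; [move=> /andP[]|move=> [-> ->]].
- by left; exact: compact_superlevel.
- by right; rewrite -E; exact: open_superlevel.
- by rewrite -subset0 => x /= [/andP[_]]; rewrite ltNge => /negbTE ->.
Qed.

(** For a bounded interval with end points [a < b], both sides are differences of the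
    mass of the ray above [a] and that of the closed ray from [b]. *)
Lemma open_interval_le (J : set R) : open J -> is_interval J ->
  J `<=` [set s | (0 < s)%R] -> r J <= mu (h @^-1` J).
Proof.
move=> oJ iJ J0.
have [->|/set0P [s0 Js0]] := eqVneq J set0.
  by rewrite measure0; exact: DTM_ge0.
have lbJ : has_lbound J by exists 0%R => s /J0 /ltW.
have oJe s : J s -> exists2 e : R, (0 < e)%R & forall u, (`|s - u| < e)%R -> J u.
  move=> Js; have : nbhs s J by exact: open_nbhs_nbhs.
  by move=> /nbhs_ballP[e /= e0 sJ]; exists e => // u; exact: sJ.
pose a := inf J.
have aJ s : J s -> (a < s)%R.
  move=> Js; have [e e0 eJ] := oJe s Js.
  have : J (s - e / 2)%R.
    by apply: eJ; rewrite opprB addrC subrK ger0_norm ?divr_ge0 ?ltW// ltr_pdivrMr// ltr_pMr// ltr1n.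
  move=> /(ge_inf lbJ) /le_lt_trans; apply.
  by rewrite gtrDl oppr_lt0 divr_gt0.
have Ja s : (a < s)%R -> exists2 u, J u & (u < s)%R.
  move=> as_; have e0 : (0 < s - a)%R by rewrite subr_gt0.
  have hi : has_inf J by split => //; exists s0.
  by have [u Ju us] := inf_adherent e0 hi; exists u => //; move: us; rewrite addrC subrK.
have a0 : (0 <= a)%R by apply: lb_le_inf; [exists s0|move=> s /J0 /ltW].
have [ubJ|nubJ] := pselect (has_ubound J); last first.
  have JE : J = `]a, +oo[%classic.
    apply/seteqP; split => s /=; rewrite in_itv/= andbT; first exact: aJ.
    move=> /Ja [u Ju us]; have [v Jv sv] : exists2 v, J v & (s < v)%R.
      apply: contrapT => nv; apply: nubJ; exists s => v Jv.
      by rewrite leNgt; apply/negP => sv; apply: nv; exists v.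
    by apply: (iJ _ _ Ju Jv); rewrite !ltW.
  by rewrite [in leLHS]JE ray JE preimage_ray.
pose b := sup J.
have Jb s : J s -> (s < b)%R.
  move=> Js; have [e e0 eJ] := oJe s Js.
  have : J (s + e / 2)%R.
    apply: eJ; rewrite opprD addrA subrr add0r normrN.
    by rewrite ger0_norm ?divr_ge0 ?ltW// ltr_pdivrMr// ltr_pMr// ltr1n.
  by move=> /(ub_le_sup ubJ); apply: lt_le_trans; rewrite ltrDl divr_gt0.
have bJ s : (s < b)%R -> exists2 u, J u & (s < u)%R.
  move=> sb; have e0 : (0 < b - s)%R by rewrite subr_gt0.
  have hs : has_sup J by split => //; exists s0.
  by have [u Ju us] := sup_adherent e0 hs; exists u => //; move: us; rewrite subKr.
have ab : (a < b)%R by apply: lt_trans (aJ _ Js0) (Jb _ Js0).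
have b0 : (0 < b)%R by exact: le_lt_trans ab.
have JE : J = `]a, b[%classic.
  apply/seteqP; split => s /=; rewrite in_itv/=; first by move=> Js; rewrite aJ// Jb.
  move=> /andP[/Ja [u Ju us] /bJ [v Jv sv]].
  by apply: (iJ _ _ Ju Jv); rewrite !ltW.
have hJ : h @^-1` J = [set x | (a < h x < b)%R].
  by rewrite JE; apply/seteqP; split => x /=; rewrite in_itv.
have rE : r `]a, +oo[%classic = r J + r `[b, +oo[%classic.
  rewrite -measureU.
  - congr (r _); rewrite JE; apply/seteqP; split => s /=; rewrite !in_itv/= !andbT.
      by move=> ->; have [|] := ltP s b; [left|right].
    by move=> [/andP[]//|]; exact: lt_le_trans.
  - by rewrite JE; exact: measurable_itv.
  - exact: measurable_itv.
  - by rewrite JE -subset0 => s /= []; rewrite !in_itv/= andbT => /andP[_ sb]; rewrite leNgt sb.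
have fb : r `[b, +oo[%classic \is a fin_num by apply: rfin; exact: measurable_itv.
apply: (leeD2rI fb); rewrite -rE ray (level_gt_split b0 ab) -hJ leeD2l//.
exact: level_ge_le.
Qed.

(** An open set is a countable disjoint union of open intervals, and [mu] is
    superadditive. *)
Lemma open_le (V : set R) : open V -> V `<=` [set s | (0 < s)%R] ->
  r V <= mu (h @^-1` V).
Proof.
move=> oV V0; pose J := open_disjoint_itv oV.
have VE : V = \bigcup_n J n by exact: open_disjoint_itv_bigcup.
have oJ n : open (J n) by exact: open_disjoint_itv_open.
have JV n : J n `<=` V by rewrite VE => s Js; exists n.
have mJ n : measurable (J n : set (measurableTypeR R)) by exact: open_measurable.
have tJ : trivIset setT J by exact: open_disjoint_itv_trivIset.
have ohJ n : open (h @^-1` (J n)) by move/continuousP : ch; apply.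
have c1 := measure_sigma_additive (mu := r) mJ tJ.
rewrite -VE in c1.
apply: (cvge_le_bound c1) => n.
have oU m : open (\big[setU/set0]_(i < m) (h @^-1` (J i))).
  by rewrite -(bigcup_mkord m (fun i => h @^-1` (J i))); apply: bigcup_open.
apply: (@le_trans _ _ (mu (\big[setU/set0]_(i < n) (h @^-1` (J i))))); last first.
  apply: (DTM_le muD); [by left|by left; move/continuousP : ch; apply|].
  by rewrite -(bigcup_mkord n (fun i => h @^-1` (J i))) => x [i _]; exact: JV.
elim: n => [|n IH]; first by rewrite big_geq// big_ord0 (DTM_set0 muD).
have dis : \big[setU/set0]_(i < n) (h @^-1` (J i)) `&` h @^-1` (J n) = set0.
  rewrite -subset0 -(bigcup_mkord n (fun i => h @^-1` (J i))) => x [[i /= ni Jx] Jnx].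
  have := tJ i n I I; move: ni => /[swap] ->; first by rewrite ltnn.
  by exists (h x).
rewrite big_nat_recr//= big_ord_recr/= (DTM_openU hX muD (oU n) (ohJ n) dis).
apply: leeD; first exact: IH.
apply: open_interval_le => //.
  exact: open_disjoint_itv_is_interval.
by move=> s /JV /V0.
Qed.

(** Let [V] be the complement of [C] in the ray above [a].  Both [C] and [V] have
    preimages of mass at least their Stieltjes mass, for [C] by outer regularity and
    compactness, and additivity of [mu] makes the sums of the masses equal. *)
Lemma compact_level (C : set R) (a : R) : compact C -> (0 < a)%R ->
  C `<=` [set s | (a < s)%R] -> mu (h @^-1` C) = r C.
Proof.
move=> cC a0 Ca.
have clC : closed C by apply: compact_closed => //; exact: Rhausdorff.
have mC : measurable (C : set (measurableTypeR R)) by exact: closed_measurable.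
pose H := [set x | (a <= h x)%R].
have cH : compact H by exact: compact_superlevel.
have clhC : closed (h @^-1` C) by apply: closed_comp => // x _; exact: ch.
have hCH : h @^-1` C `<=` H by move=> x /Ca /ltW.
have chC : compact (h @^-1` C) by exact: (subclosed_compact clhC cH hCH).
have ge_C : r C <= mu (h @^-1` C).
  have [[_ _ _ orc] _ _] := muD; rewrite (orc _ clhC).
  apply: le_ereal_inf_tmp => _ [U [oU CU] <-].
  have cE : compact (h @` (H `\` U)).
    apply: continuous_compact; first exact: continuous_subspaceT.
    apply: (subclosed_compact _ cH); last exact: subDsetl.
    by apply: closedI; [exact: closed_superlevel|exact: open_closedC].
  have clE : closed (h @` (H `\` U)) by apply: compact_closed => //; exact: Rhausdorff.
  (* Points of [H] outside [U] have values at positive distance from [C]. *)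
  pose V := [set s | (a < s)%R] `&` ~` (h @` (H `\` U)).
  have oV : open V.
    by apply: openI; [exact: open_gt|exact: closed_openC].
  have CV : C `<=` V.
    move=> s Cs; split; first exact: Ca.
    by move=> [x [Hx nUx] hx]; apply/nUx/CU; rewrite /preimage/= hx.
  apply: (@le_trans _ _ (r V)).
    by apply: le_measure; rewrite ?inE//; exact: open_measurable.
  apply: (@le_trans _ _ (mu (h @^-1` V))).
    by apply: open_le => // s [/= /(lt_trans a0)].
  apply: (DTM_le muD); [by left; move/continuousP : ch; apply|by left|].
  move=> x [/= ax nE]; apply: contrapT => nUx; apply: nE.
  by exists x => //; split => //; exact: ltW.
pose V := [set s : R | (a < s)%R] `&` ~` C.
have oV : open V by apply: openI; [exact: open_gt|exact: closed_openC].
have mV : measurable (V : set (measurableTypeR R)) by exact: open_measurable.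
have ge_V : r V <= mu (h @^-1` V).
  by apply: open_le => // s [/= /(lt_trans a0)].
have E : [set s : R | (a < s)%R] = C `|` V.
  apply/seteqP; split => s /=.
    by move=> as_; have [|] := pselect (C s); [left|right].
  by move=> [/Ca//|[]].
have rE : r `]a, +oo[%classic = r C + r V.
  rewrite -measureU//; last by rewrite -subset0 => s [Cs [_]].
  by congr (r _); rewrite -E; apply/seteqP; split => s /=; rewrite in_itv/= andbT.
have muE : mu [set x | (a < h x)%R] = mu (h @^-1` C) + mu (h @^-1` V).
  have E' : [set x | (a < h x)%R] = h @^-1` C `|` h @^-1` V.
    by rewrite -preimage_setU -E.
  rewrite E' tmU//.
  - by left.
  - by right; move/continuousP : ch; apply.
  - by right; rewrite -E'; exact: open_superlevel.
  - by rewrite -preimage_setI -subset0 => x [Cx [_]].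
apply/eqP; rewrite eq_le ge_C andbT.
apply: (leeD2rI (rfin mV)); rewrite -rE ray muE leeD2l//.
Qed.

End level_sets_of_topological_measures.

(** * Additivity on the functions of one function *)

Section additivity_on_functions_of_one_function.
Local Open Scope ereal_scope.
Local Opaque Pi signed_Pi.
Context {R : realType} {X : ptopologicalType}.
Hypotheses (hX : hausdorff_space X) (cX : connected [set: X]).
Implicit Types (f g h : X -> R) (U V W : set X).

(** [g] is a function of [h]; as for monotone functions, no function on the real line
    is chosen. *)
Definition factors_through h g := forall x y, h x = h y -> g x = g y.

Definition vanishes_with h g := forall x, h x = 0%R -> g x = 0%R.

Lemma ex_lift h g : factors_through h g -> exists phi : R -> R,
  (forall x, phi (h x) = g x) /\ (forall s, ~ range h s -> phi s = 0%R).
Proof.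
move=> hg; suff /choice [phi phiP] : forall s, exists v,
    (forall x, h x = s -> v = g x) /\ (~ range h s -> v = 0%R).
  exists phi; split => [x|s]; first by case: (phiP (h x)) => /(_ x erefl).
  by case: (phiP s).
move=> s; have [[x _ hx]|ns] := pselect (range h s).
  exists (g x); split => [y hy|]; first by apply: hg; rewrite hx hy.
  by case; exists x.
exists 0%R; split => // x hx; exfalso; apply: ns; by exists x.
Qed.

Variable mu : set X -> \bar R.
Hypotheses (muD : DTM R X mu) (muT : TM R X mu).

Section lift.
Variables (h g : X -> R) (phi : R -> R).
Hypotheses (hp : C0plus R X h) (gp : C0plus R X g) (gh : vanishes_with h g)
  (phih : forall x, phi (h x) = g x) (phi0 : forall s, ~ range h s -> phi s = 0%R).

Let r := ls_measure (fun t => - R1 mu h t)%R.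

Lemma lift_ge0 s : (0 <= phi s)%R.
Proof.
have [[x _ <-]|/phi0 ->//] := pselect (range h s).
by rewrite phih gp.2.
Qed.

(** Superlevel sets of the lift at positive heights are compact, being images of
    compact sets; this gives measurability of the lift. *)
Lemma lift_level (t : R) : (0 < t)%R ->
  [set s | (t <= phi s)%R] = h @` [set x | (t <= g x)%R].
Proof.
move=> t0; apply/seteqP; split => s /=; last first.
  by move=> [x tg <-]; rewrite phih.
have [[x _ <-]|/phi0 ->] := pselect (range h s); last by rewrite leNgt t0.
by rewrite phih => tg; exists x.
Qed.

Lemma compact_lift_level (t : R) : (0 < t)%R -> compact [set s | (t <= phi s)%R].
Proof.
move=> t0; rewrite lift_level//; apply: continuous_compact.
  by apply: continuous_subspaceT; exact: hp.1.1.
exact: compact_superlevel.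
Qed.

Lemma measurable_lift_level (t : R) : (0 < t)%R ->
  measurable ([set s | (t <= phi s)%R] : set (measurableTypeR R)).
Proof.
move=> t0; apply: closed_measurable; apply: compact_closed; first exact: Rhausdorff.
exact: compact_lift_level.
Qed.

Lemma measurable_lift : measurable_fun [set: measurableTypeR R] phi.
Proof.
apply: (measurability (@RGenCInfty.G R)) => [|/= _ [_ [t ->] <-]].
  exact: RGenCInfty.measurableE.
rewrite setTI; have [t0|t0] := leP t 0%R.
  rewrite (_ : _ @^-1` _ = setT)//.
  apply/seteqP; split => s //= _; rewrite in_itv/= andbT (le_trans t0)//.
  exact: lift_ge0.
rewrite (_ : _ @^-1` _ = [set s | (t <= phi s)%R]); first exact: measurable_lift_level.
by apply/seteqP; split => s /=; rewrite in_itv/= andbT.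
Qed.

(** The level set is compact and [h] is positive on it, as [g] vanishes with [h]; so
    [h] is bounded away from 0 there and [compact_level] applies. *)
Lemma ls_lift_ge (t : R) : (0 < t)%R ->
  r [set s | (t <= phi s)%R] = mu [set x | (t <= g x)%R].
Proof.
move=> t0; have cC := compact_lift_level t0.
have [E|/set0P ne] := eqVneq [set x | (t <= g x)%R] set0.
  by rewrite lift_level// E image_set0 measure0 (DTM_set0 muD).
have [c cK cmin] := compact_EVT_min ne (compact_superlevel gp t0)
  (continuous_subspaceT hp.1.1).
(* [c] minimises [h] on the level set. *)
have hc0 : (0 < h c)%R.
  rewrite lt_neqAle hp.2 andbT; apply/eqP => /esym /gh gc.
  by move: cK; rewrite inE/= gc leNgt t0.
have ah : (0 < h c / 2)%R by rewrite divr_gt0.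
rewrite -(compact_level hX muD muT hp cC ah); last first.
  move=> s; rewrite lift_level// => -[x tg <-] /=.
  by rewrite (lt_le_trans _ (cmin x _)) ?inE// ltr_pdivrMr// ltr_pMr// ltr1n.
by congr (mu _); apply/seteqP; split => x /=; rewrite phih.
Qed.

(** The strict superlevel set is approximated from inside by the nonstrict ones, on
    the real line by continuity from below and on [X] by inner regularity. *)
Lemma ls_lift_gt (t : R) : (0 <= t)%R ->
  r [set s | (t < phi s)%R] = mu [set x | (t < g x)%R].
Proof.
move=> t0; have mphi := measurable_lift.
pose F n : set (measurableTypeR R) := [set s | (t + n.+1%:R^-1 <= phi s)%R].
have tn n : (0 < t + n.+1%:R^-1)%R by rewrite ltr_wpDl.
have FE : [set s | (t < phi s)%R] = \bigcup_n F n.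
  apply/seteqP; split => s /=; last first.
    by move=> [n _]; rewrite /F/=; apply: lt_le_trans; rewrite ltrDl.
  move=> ts; have [n nt] : exists n, (n.+1%:R^-1 < phi s - t)%R.
    by apply: ex_invn_lt; rewrite subr_gt0.
  by exists n => //; rewrite /F/= addrC -lerBrDr ltW.
have mF n : measurable (F n) by exact: measurable_lift_level.
have c1 : r \o F @ \oo --> r (\bigcup_n F n).
  apply: nondecreasing_cvg_mu => //; first exact: bigcupT_measurable.
  move=> m n mn; apply/subsetPset => s; rewrite /F/=; apply: le_trans.
  by rewrite lerD2l lef_pV2 ?posrE// ler_nat.
apply/eqP; rewrite eq_le; apply/andP; split.
  rewrite [in leLHS]FE; apply: (cvge_le_bound c1) => n /=.
  rewrite /F ls_lift_ge//; apply: (DTM_le muD).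
  - by apply: compact_oc => //; exact: compact_superlevel.
  - by apply: superlevel_oc; exact: gp.1.1.
  - by move=> x /=; apply: lt_le_trans; rewrite ltrDl.
have [[_ _ iro _] _ _] := muD.
rewrite (iro [set x | (t < g x)%R]); last by apply: open_superlevel; exact: gp.1.1.
apply: ge_ereal_sup => _ [D [cD Dg] <-].
have [D0|/set0P Dn] := eqVneq D set0; first by rewrite D0 (DTM_set0 muD).
have [c cK cmin] := compact_EVT_min Dn cD (continuous_subspaceT gp.1.1).
have tc : (t < g c)%R by apply: Dg; rewrite inE in cK.
apply: (@le_trans _ _ (mu [set x | (g c <= g x)%R])).
  apply: (DTM_le muD); first exact: compact_oc.
    by apply: compact_oc => //; apply: compact_superlevel => //; exact: le_lt_trans tc.
  by move=> x Dx /=; apply: cmin; rewrite inE.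
rewrite -ls_lift_ge; last exact: le_lt_trans tc.
apply: le_measure; rewrite ?inE.
- by apply: measurable_lift_level; exact: le_lt_trans tc.
- by rewrite FE; exact: bigcupT_measurable.
- by move=> s /=; exact: lt_le_trans.
Qed.

Lemma Pi_lift : Pi mu g = \int[r]_s (phi s)%:E.
Proof.
have [M _ hM] := C0_bounded hp.1.
apply: Pi_layer => //.
- by rewrite (ls_setT muD hp.1.1 hM); case: muD.
- exact: measurable_lift.
- exact: lift_ge0.
- exact: ls_lift_gt.
Qed.

End lift.

Definition functions_of h : set (X -> R) :=
  [set g | [/\ C0plus R X g, factors_through h g & vanishes_with h g]].

Lemma functions_ofD h f g : functions_of h f -> functions_of h g ->
  functions_of h (fun x => f x + g x)%R.
Proof.
move=> [f0 hf vf] [g0 hg vg]; split.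
- by split; [apply: C0_add; [exact: f0.1|exact: g0.1]|move=> x; rewrite addr_ge0 ?f0.2 ?g0.2].
- by move=> x y xy; rewrite (hf _ _ xy) (hg _ _ xy).
- by move=> x hx; rewrite vf// vg// addr0.
Qed.

Lemma Pi_functions_ofD h f g : C0plus R X h -> functions_of h f ->
  functions_of h g -> Pi mu (fun x => f x + g x)%R = Pi mu f + Pi mu g.
Proof.
move=> hp hf hg; have [f0 ff vf] := hf; have [g0 gf vg] := hg.
have [s0 _ vs] := functions_ofD hf hg.
have [phi [phif phi0]] := ex_lift ff; have [psi [psig psi0]] := ex_lift gf.
rewrite (Pi_lift hp f0 vf phif phi0) (Pi_lift hp g0 vg psig psi0).
rewrite (Pi_lift (phi := fun s => phi s + psi s)%R hp s0 vs); last 2 first.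
- by move=> x; rewrite phif psig.
- by move=> s ns; rewrite phi0// psi0// addr0.
under eq_integral do rewrite EFinD.
rewrite ge0_integralD//.
- by move=> s _; rewrite lee_fin; exact: (lift_ge0 f0 phif phi0).
- by apply/measurable_EFinP; exact: (measurable_lift hp f0 phif phi0).
- by move=> s _; rewrite lee_fin; exact: (lift_ge0 g0 psig psi0).
- by apply/measurable_EFinP; exact: (measurable_lift hp g0 psig psi0).
Qed.

Lemma signed_Pi_functions_ofD h f g : C0plus R X h -> C0 R X f -> C0 R X g ->
  factors_through h f -> factors_through h g -> vanishes_with h f ->
  vanishes_with h g ->
  signed_Pi mu (fun x => f x + g x)%R = signed_Pi mu f + signed_Pi mu g.
Proof.
move=> hp f0 g0 ff gf vf vg.
have pos u : C0 R X u -> factors_through h u -> vanishes_with h u ->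
    functions_of h (u^\+)%R.
  move=> u0 uf vu; split; first exact: C0_pos.
  - by move=> x y xy; rewrite /funrpos (uf _ _ xy).
  - by move=> x hx; rewrite /funrpos vu// max_r.
have neg u : C0 R X u -> factors_through h u -> vanishes_with h u ->
    functions_of h (u^\-)%R.
  move=> u0 uf vu; split; first exact: C0_neg.
  - by move=> x y xy; rewrite /funrneg (uf _ _ xy).
  - by move=> x hx; rewrite /funrneg vu// oppr0 max_r.
have s0 := C0_add f0 g0.
have sf : factors_through h (fun x => f x + g x)%R.
  by move=> x y xy; rewrite (ff _ _ xy) (gf _ _ xy).
have sv : vanishes_with h (fun x => f x + g x)%R.
  by move=> x hx; rewrite vf// vg// addr0.
apply: (signed_Pi_add cX muD (P := functions_of h)); [| |exact: pos|exact: neg|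
  exact: pos|exact: neg|exact: pos|exact: neg].
- by move=> u v; exact: functions_ofD.
- by move=> u v; exact: Pi_functions_ofD.
Qed.

Lemma signed_Pi_disjoint f g : C0 R X f -> C0 R X g ->
  (forall x, f x * g x = 0)%R ->
  signed_Pi mu (fun x => f x + g x)%R = signed_Pi mu f + signed_Pi mu g.
Proof.
move=> f0 g0 fg0.
have alt x : f x = 0%R \/ g x = 0%R.
  by have /eqP := fg0 x; rewrite mulf_eq0 => /orP[/eqP ->|/eqP ->]; [left|right].
rewrite !signed_PiE.
have -> : ((fun x => f x + g x)^\+ = (fun x => f^\+ x + g^\+ x))%R.
  apply/funext => x; rewrite /funrpos.
  by case: (alt x) => ->; rewrite ?add0r ?addr0 maxxx ?add0r ?addr0.
have -> : ((fun x => f x + g x)^\- = (fun x => f^\- x + g^\- x))%R.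
  apply/funext => x; rewrite /funrneg.
  by case: (alt x) => ->; rewrite ?add0r ?addr0 oppr0 maxxx ?add0r ?addr0.
rewrite (Pi_disjoint hX muD (C0_pos f0) (C0_pos g0)); last first.
  by move=> x; rewrite /funrpos; case: (alt x) => ->; rewrite maxxx ?mul0r ?mulr0.
rewrite (Pi_disjoint hX muD (C0_neg f0) (C0_neg g0)); last first.
  by move=> x; rewrite /funrneg; case: (alt x) => ->; rewrite oppr0 maxxx ?mul0r ?mulr0.
move: (Pi_fin cX f^\+%R muD) (Pi_fin cX f^\-%R muD) (Pi_fin cX g^\+%R muD) (Pi_fin cX g^\-%R muD).
move: (Pi mu f^\+%R) (Pi mu f^\-%R) (Pi mu g^\+%R) (Pi mu g^\-%R).
move=> a b c d fa fb fc fd; exact: fin_num_subD.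
Qed.

End additivity_on_functions_of_one_function.

(** * From topological measures to quasi-linear functionals *)

Section subalgebra_of_functions_of_one_function.
Context {R : realType} {X : ptopologicalType}.
Implicit Types (f g h : X -> R).

Lemma closure_uniform (A : set (X -> R)) g (e : R) :
  closure (A : set {uniform X -> R}) g -> 0 < e ->
  exists2 f, A f & forall x, `|g x - f x| < e.
Proof.
move=> Ag e0.
have /Ag [f [Af gf]] : nbhs (g : {uniform X -> R})
    [set f : {uniform X -> R} | forall x, `|g x - f x| < e].
  apply/uniform_nbhs; exists [set xy : R * R | `|xy.1 - xy.2| < e].
  split; first by rewrite -entourage_ballE; exists e.
  by move=> f /= H x; exact: H.
by exists f.
Qed.

Lemma C0_closed : closed (C0 R X : set {uniform X -> R}).
Proof.
move=> g Cg; have cg : continuous g.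
  move=> x; apply/cvgrPdist_lt => e e0.
  have e30 : 0 < e / 3 by rewrite divr_gt0.
  have [f [cf _] gf] := closure_uniform Cg e30.
  have /cvgrPdist_lt /(_ _ e30) := cf x; apply: filterS => y fxy.
  have -> : g x - g y = (g x - f x) + (f x - f y) + (f y - g y) by ring.
  have -> : e = e / 3 + e / 3 + e / 3 by field.
  apply: le_lt_trans (ler_normD _ _) _; apply: ltrD; last by rewrite distrC.
  by apply: le_lt_trans (ler_normD _ _) _; apply: ltrD.
split => // e e0; have e20 : 0 < e / 2 by rewrite divr_gt0.
have [f [_ vf] gf] := closure_uniform Cg e20.
apply: (subclosed_compact _ (vf _ e20)).
  by apply: closed_superlevel; exact: continuous_normf.
move=> x /= eg; have := gf x; have := ler_normD (g x - f x) (f x).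
by rewrite subrK; lra.
Qed.

(** An upper bound for [Balg h], defined by pointwise conditions that pass to
    uniform limits. *)
Definition generated_by h : set (X -> R) :=
  [set g | [/\ C0 R X g, factors_through h g &
    ~ compact [set: X] -> vanishes_with h g]].

Lemma generated_by_subalgebra h : closed_subalgebra (generated_by h).
Proof.
split.
- by move=> g [].
- by split => //; exact: C0_cst0.
- move=> a b f g [f0 hf vf] [g0 hg vg]; split; first exact: C0_lin.
    by move=> x y xy; rewrite (hf _ _ xy) (hg _ _ xy).
  by move=> nX x hx; rewrite vf// vg// !mulr0 addr0.
- move=> f g [f0 hf vf] [g0 hg vg]; split; first exact: C0_mul.
    by move=> x y xy /=; rewrite (hf _ _ xy) (hg _ _ xy).
  by move=> nX x hx /=; rewrite vf// mul0r.
move=> g cg; have near (e : R) : 0 < e ->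
    exists2 f, generated_by h f & forall x, `|g x - f x| < e.
  exact: closure_uniform.
split.
- by apply: C0_closed; move=> B /cg [f [[f0 _ _] Bf]]; exists f.
- move=> x y xy; apply/eqP; rewrite -subr_eq0 -normr_le0; apply/ler_addgt0Pr => e e0.
  have e20 : 0 < e / 2 by rewrite divr_gt0.
  have [f [_ hf _] gf] := near _ e20.
  have -> : g x - g y = (g x - f x) + (f y - g y) by rewrite (hf _ _ xy); ring.
  rewrite add0r [leRHS]splitr; apply: le_trans (ler_normD _ _) _.
  by apply: lerD; rewrite ltW// distrC.
- move=> nX x hx; apply/eqP; rewrite -normr_le0; apply/ler_addgt0Pr => e e0.
  have [f [_ _ vf] gf] := near _ e0.
  by have := gf x; rewrite vf// subr0 add0r => /ltW.
Qed.

Lemma Balg_generated h f : C0 R X h -> Balg h f -> generated_by h f.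
Proof.
move=> h0 hf; apply: hf; split; first exact: generated_by_subalgebra.
move=> g [->|[kX ->]]; first by split; [exact: h0|move=> x y|move=> _ x].
by split; [exact: C0_cst|by move=> x y _|by move=> nX; case: (nX kX)].
Qed.

End subalgebra_of_functions_of_one_function.

Section from_topological_measure_to_quasi_linear.
Local Open Scope ereal_scope.
Local Opaque Pi signed_Pi.
Context {R : realType} {X : ptopologicalType}.
Hypotheses (hX : hausdorff_space X) (cX : connected [set: X]).
Implicit Types (f g h : X -> R) (U V W : set X).
Variable mu : set X -> \bar R.
Hypotheses (muD : DTM R X mu) (muT : TM R X mu).

(** Additivity is known for functions of a nonnegative [k] that vanish with [k].  On a
    compact space one takes for [k] a translate of [h] that is positive everywhere.
    On a noncompact space the functions vanish where [h] does; they are cut along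
    [h > 0] and [h < 0], and the pieces are functions of the positive and the
    negative part of [h]. *)
Lemma signed_Pi_generatedD h f g : C0 R X h -> generated_by h f ->
  generated_by h g ->
  signed_Pi mu (fun x => f x + g x)%R = signed_Pi mu f + signed_Pi mu g.
Proof.
move=> h0 [f0 hf vf] [g0 hg vg].
have [kX|nX] := pselect (compact [set: X]).
  have [M M0 hM] := C0_bounded h0.
  (* Translating by more than the bound of [h] makes [k] at least 1. *)
  pose k x := (h x + (M + 1))%R.
  have k1 x : (1 <= k x)%R.
    by have := hM x; rewrite ler_norml /k => /andP[]; lra.
  have kp : C0plus R X k.
    split; last by move=> x; exact: le_trans ler01 (k1 x).
    by apply: C0_add => //; exact: C0_cst.
  have fk u : factors_through h u -> factors_through k u.
    by move=> hu x y /addIr; exact: hu.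
  have vk u : vanishes_with k u.
    by move=> x kx; have := k1 x; rewrite kx ler10.
  by apply: (signed_Pi_functions_ofD hX cX muD muT kp) => //; exact: fk.
pose U := [set x | (0 < h x)%R]; pose V := [set x | (h x < 0)%R].
have oU : open U by apply: open_superlevel; exact: h0.1.
have oV : open V by apply: open_sublevel; exact: h0.1.
have UV0 : U `&` V = set0.
  by rewrite -subset0 => x [/= /lt_trans h1 /h1]; rewrite ltxx.
have VU0 : V `&` U = set0 by rewrite setIC.
have off u : vanishes_with h u -> forall x, ~ U x -> ~ V x -> u x = 0%R.
  move=> vu x /negP; rewrite -leNgt => hx /negP; rewrite -leNgt => hx'.
  by apply: vu; apply: le_anti; rewrite hx hx'.
have cutE u : vanishes_with h u -> u = (fun x => cut U u x + cut V u x)%R.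
  move=> vu; apply/funext => x; rewrite /cut.
  have [Ux|nU] := pselect (U x).
    rewrite mem_set// memNset ?addr0// => Vx.
    by have : set0 x by rewrite -UV0.
  rewrite (memNset nU) add0r; case: ifPn => // /negP nV.
  by apply: (off u vu) => // Vx; apply: nV; rewrite inE.
have cut0 u : C0 R X u -> vanishes_with h u -> C0 R X (cut U u) /\ C0 R X (cut V u).
  move=> u0 vu; split; first exact: (cut_C0 oU oV UV0 u0 (off u vu)).
  by apply: (cut_C0 oV oU VU0 u0) => x nV nU; exact: (off u vu).
have split u : C0 R X u -> vanishes_with h u ->
    signed_Pi mu u = signed_Pi mu (cut U u) + signed_Pi mu (cut V u).
  move=> u0 vu; have [uU uV] := cut0 u u0 vu.
  rewrite {1}(cutE u vu) (signed_Pi_disjoint hX cX muD)// => x.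
  rewrite /cut; case: ifPn => [Ux|]; last by rewrite mul0r.
  rewrite memNset ?mulr0// => Vx.
  by have : set0 x by rewrite -UV0; split => //; exact: set_mem.
have cutD W : cut W (fun x => f x + g x)%R = (fun x => cut W f x + cut W g x)%R.
  by apply/funext => x; rewrite /cut; case: ifPn; rewrite ?addr0.
have {}vf := vf nX; have {}vg := vg nX.
have posU x : U x -> (h^\+ x = h x)%R by move=> /= hx; rewrite /funrpos max_l// ltW.
have posN x : ~ U x -> (h^\+ x = 0)%R.
  by move=> /negP; rewrite -leNgt /funrpos => hx; rewrite max_r.
have negV x : V x -> (h^\- x = - h x)%R.
  by move=> /= hx; rewrite /funrneg max_l// oppr_ge0 ltW.
have negN x : ~ V x -> (h^\- x = 0)%R.
  by move=> /negP; rewrite -leNgt /funrneg => hx; rewrite max_r// oppr_le0.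
have vU u : vanishes_with (h^\+)%R (cut U u).
  move=> x hx; rewrite /cut; case: ifPn => // /set_mem Ux.
  by move: hx; rewrite posU// => hx; move: Ux; rewrite /U/= hx ltxx.
have vV u : vanishes_with (h^\-)%R (cut V u).
  move=> x hx; rewrite /cut; case: ifPn => // /set_mem Vx.
  move: hx; rewrite negV// => /eqP; rewrite oppr_eq0 => /eqP hx.
  by move: Vx; rewrite /V/= hx ltxx.
have fU u : factors_through h u -> factors_through (h^\+)%R (cut U u).
  move=> hu x y xy; have [Ux|nU] := pselect (U x); last first.
    by rewrite !(vU u)//; [rewrite -xy posN|rewrite posN].
  have [Uy|nU] := pselect (U y); last first.
    by rewrite !(vU u)//; [rewrite posN|rewrite xy posN].
  by rewrite /cut !mem_set//; apply: hu; move: xy; rewrite !posU.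
have fV u : factors_through h u -> factors_through (h^\-)%R (cut V u).
  move=> hu x y xy; have [Vx|nV] := pselect (V x); last first.
    by rewrite !(vV u)//; [rewrite -xy negN|rewrite negN].
  have [Vy|nV] := pselect (V y); last first.
    by rewrite !(vV u)//; [rewrite negN|rewrite xy negN].
  by rewrite /cut !mem_set//; apply: hu; move: xy; rewrite !negV// => /oppr_inj.
have s0 : C0 R X (fun x => f x + g x)%R by exact: C0_add.
have vs : vanishes_with h (fun x => f x + g x)%R.
  by move=> x hx; rewrite vf// vg// addr0.
have [fU0 fV0] := cut0 f f0 vf; have [gU0 gV0] := cut0 g g0 vg.
rewrite (split _ s0 vs) (split f f0 vf) (split g g0 vg) !cutD.
rewrite (signed_Pi_functions_ofD hX cX muD muT (C0_pos h0) fU0 gU0 (fU f hf) (fU g hg) (vU f) (vU g)).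
rewrite (signed_Pi_functions_ofD hX cX muD muT (C0_neg h0) fV0 gV0 (fV f hf) (fV g hg) (vV f) (vV g)).
exact: addeACA.
Qed.

Lemma TM_quasi_linear : quasi_linear_functional (signed_Pi mu).
Proof.
split.
- by move=> f _; exact: signed_Pi_fin.
- by move=> a f f0; exact: signed_Pi_scale.
- move=> h h0 f g hf hg.
  by apply: (signed_Pi_generatedD h0); exact: Balg_generated.
- by move=> f f0 fp; rewrite (signed_Pi_pos cX muD fp) Pi_ge0.
Qed.

End from_topological_measure_to_quasi_linear.

(** * The correspondence *)

Theorem theorem8p7 (R : realType) (X : ptopologicalType)
    (lcX : locally_compact [set: X]) (hX : hausdorff_space X)
    (cX : connected [set: X]) :
  [/\ (* I *) conic_linear_on_DTM (@Pi R X),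
      (* II *) order_preserving_on_DTM (@Pi R X),
      (* III *) (forall mu : set X -> \bar R, DTM R X mu ->
        let rho := fun f : X -> R => (Pi mu (f^\+)%R - Pi mu (f^\-)%R)%E in
        (TM R X mu <-> quasi_linear_functional rho) /\
        (Mreg R X mu <-> linear_functional rho)),
      (* IV *) norm_total_mass_on_DTM (@Pi R X)
    & (* V *) [/\ set_bij (DTM R X) (Phiplus R X) (@Pi R X),
          conic_linear_on_DTM (@Pi R X),
          order_preserving_on_DTM (@Pi R X)
        & norm_total_mass_on_DTM (@Pi R X)]].
Proof.
have conic : conic_linear_on_DTM (@Pi R X).
  move=> c d mu nu c0 d0 muD nuD; split; first exact: conic_comb_DTM.
  exact: Pi_conic.
have order : order_preserving_on_DTM (@Pi R X).
  by move=> mu nu muD nuD; exact: Pi_order.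
have norm : norm_total_mass_on_DTM (@Pi R X).
  by move=> mu muD; exact: Pi_norm.
split; [exact: conic|exact: order| |exact: norm|]; last first.
  by split; [exact: Pi_bij|exact: conic|exact: order|exact: norm].
move=> mu muD rho; split; split.
- by move=> muT; exact: (TM_quasi_linear hX cX muD muT).
- by move=> ql; exact: (quasi_linear_TM hX cX lcX muD ql).
- by move=> muM; exact: (Mreg_linear cX muD muM).
- by move=> lin; exact: (linear_Mreg hX cX lcX muD lin).
Qed.
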